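(* Let $\mathbb K$ be an algebraically closed field, $n\ge2$, and $r,s\in\mathbb K$ nonzero with $r\ne s$. Let $\widehat U$ be the Hopf algebra defined in the context. There is a Hopf algebra morphism $\phi:\widehat U\to U_{r,s}(\mathfrak{gl}_n)$ given by $$\phi(L_i)=a_1\cdots a_{i-1}b_{i+1}^{-1}\cdots b_n^{-1},\qquad \phi(K_i)=b_1^{-1}\cdots b_{i-1}^{-1}a_{i+1}\cdots a_n\qquad(1\le i\le n),$$ $$\phi(E_i)=-s^{-1}(r-s)^2e_i,\qquad\phi(F_i)=(\omega_i')^{-1}f_i\qquad(1\le i<n).$$
   Context: Let $\epsilon_1,\dots,\epsilon_n$ be an orthonormal basis of $\mathbb R^n$ with inner product $\langle\,,\rangle$ and $\alpha_j=\epsilon_j-\epsilon_{j+1}$ for $1\le j<n$. $\widetilde U=U_{r,s}(\mathfrak{gl}_n)$ is the unital associative $\mathbb K$-algebra generated by $e_j,f_j$ ($1\le j<n$), $a_i^{\pm1},b_i^{\pm1}$ ($1\le i\le n$) with relations: (R1) the $a_i^{\pm1},b_j^{\pm1}$ all commute and $a_ia_i^{-1}=b_jb_j^{-1}=1$; (R2) $a_ie_j=r^{\langle\epsilon_i,\alpha_j\rangle}e_ja_i$, $a_if_j=r^{-\langle\epsilon_i,\alpha_j\rangle}f_ja_i$; (R3) $b_ie_j=s^{\langle\epsilon_i,\alpha_j\rangle}e_jb_i$, $b_if_j=s^{-\langle\epsilon_i,\alpha_j\rangle}f_jb_i$; (R4) $[e_i,f_j]=\frac{\delta_{i,j}}{r-s}(a_ib_{i+1}-a_{i+1}b_i)$;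 (R5) $[e_i,e_j]=[f_i,f_j]=0$ if $|i-j|>1$; (R6) $e_i^2e_{i+1}-(r+s)e_ie_{i+1}e_i+rs\,e_{i+1}e_i^2=0$, $e_ie_{i+1}^2-(r+s)e_{i+1}e_ie_{i+1}+rs\,e_{i+1}^2e_i=0$; (R7) $f_i^2f_{i+1}-(r^{-1}+s^{-1})f_if_{i+1}f_i+r^{-1}s^{-1}f_{i+1}f_i^2=0$, $f_if_{i+1}^2-(r^{-1}+s^{-1})f_{i+1}f_if_{i+1}+r^{-1}s^{-1}f_{i+1}^2f_i=0$. With $\omega_j=a_jb_{j+1}$, $\omega_j'=a_{j+1}b_j$, it is a Hopf algebra with $a_i^{\pm1},b_i^{\pm1}$ group-like, $\Delta(e_i)=e_i\otimes1+\omega_i\otimes e_i$, $\Delta(f_i)=1\otimes f_i+f_i\otimes\omega_i'$, $\varepsilon(e_i)=\varepsilon(f_i)=0$, $S(e_i)=-\omega_i^{-1}e_i$, $S(f_i)=-f_i(\omega_i')^{-1}$. $\widehat U$ is the Hopf algebra generated by $E_i,F_i$ ($1\le i<n$), $K_i^{\pm1},L_i^{\pm1}$ ($1\le i\le n$) with relations: - the $K_i^{\pm1},L_j^{\pm1}$ all commute and $K_iK_i^{-1}=L_iL_i^{-1}=1$; - $K_jE_i=r^{-\delta_{i,j}}s^{-\delta_{i,j-1}}E_iK_j$ and $K_jF_i=r^{\delta_{i,j}}s^{\delta_{i,j-1}}F_iK_j$; - $L_jE_i=r^{\delta_{i,j-1}}s^{\delta_{i,j}}E_iL_j$ and $L_jF_i=r^{-\delta_{i,j-1}}s^{-\delta_{i,j}}F_iL_j$;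 - $E_iF_i-r^{-1}sF_iE_i=(r^{-1}s-1)(L_{i+1}K_{i+1}L_i^{-1}K_i^{-1}-1)$; - $E_iF_j=r^{\delta_{i,j+1}}s^{-\delta_{i,j-1}}F_jE_i$ if $i\ne j$; - $\mathrm{ad}_\ell(E_i)^{1-\langle\alpha_i,\alpha_j\rangle}(E_j)=0$ and $\mathrm{ad}_\ell(F_i)^{1-\langle\alpha_i,\alpha_j\rangle}(F_j)=0$ if $i\ne j$, where $\mathrm{ad}_\ell(h)(x)=\sum h_{(1)}xS(h_{(2)})$ is the left adjoint action, i.e. $\mathrm{ad}_\ell(E_i)(x)=E_ix-L_{i+1}L_i^{-1}\,x\,L_iL_{i+1}^{-1}E_i$ and $\mathrm{ad}_\ell(F_i)(x)=F_ix-K_{i+1}K_i^{-1}\,x\,K_iK_{i+1}^{-1}F_i$. The Hopf structure has $K_i,L_i$ group-like, $\Delta(E_i)=E_i\otimes1+L_{i+1}L_i^{-1}\otimes E_i$, $\Delta(F_i)=F_i\otimes1+K_{i+1}K_i^{-1}\otimes F_i$. *)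

(* Defs.v *)
(* MathComp, with multinomials for free modules and free monoid algebras, and
   boolp to decide membership in the subspaces quotiented by. *)
From HB Require Import structures.
From mathcomp Require Import all_boot all_order all_algebra.
From mathcomp Require Import finmap monalg boolp.

Set Implicit Arguments.
Unset Strict Implicit.
Unset Printing Implicit Defensive.

Import GRing.Theory Num.Theory.
Local Open Scope ring_scope.
Local Open Scope quotient_scope.

(* One key per locked operation, so that unification never compares two of them. *)
Fact lpi_key : unit. Proof. exact: tt. Qed.
Fact lscale_key : unit. Proof. exact: tt. Qed.
Fact pure_key : unit. Proof. exact: tt. Qed.
Fact tlift_key : unit. Proof. exact: tt. Qed.
Fact tmul_key : unit. Proof. exact: tt. Qed.
Fact fopp_key : unit. Proof. exact: tt. Qed.
Fact fadd_key : unit. Proof. exact: tt. Qed.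
Fact fscale_key : unit. Proof. exact: tt. Qed.
Fact fmul_key : unit. Proof. exact: tt. Qed.
Fact fgen_key : unit. Proof. exact: tt. Qed.
Fact pmul_key : unit. Proof. exact: tt. Qed.
Fact feval_key : unit. Proof. exact: tt. Qed.

Section LinearQuotient.
Variables (K : fieldType) (V : lmodType K) (R : V -> Prop).

Inductive span : V -> Prop :=
| span_gen v : R v -> span v
| span_0 : span 0
| span_D u v : span u -> span v -> span (u + v)
| span_Z c v : span v -> span (c *: v).

Definition spanb : {pred V} := fun v => `[< span v >].

Lemma spanbP v : reflect (span v) (v \in spanb).
Proof. exact: asboolP. Qed.

Lemma spanb_zmod_closed : zmod_closed spanb.
Proof.
split=> [|u v /spanbP su /spanbP sv]; apply/spanbP; first exact: span_0.
by apply: span_D => //; rewrite -scaleN1r; apply: span_Z.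
Qed.

HB.instance Definition _ := GRing.isZmodClosed.Build V spanb spanb_zmod_closed.

Definition lquot := Quotient.quot (spanb : zmodClosed V).
HB.instance Definition _ := GRing.Zmodule.on lquot.

Definition lpi : V -> lquot :=
  locked_with lpi_key (\pi_(Quotient.quot (spanb : zmodClosed V))).

Lemma lpiK (x : lquot) : lpi (repr x) = x.
Proof. by rewrite [lpi]unlock; exact: reprK. Qed.

Lemma lpi_eq u v : lpi u = lpi v <-> span (u - v).
Proof.
rewrite [lpi]unlock; split.
  by move/eqP; rewrite -Quotient.idealrBE => /spanbP.
by move=> s; apply/eqP; rewrite -Quotient.idealrBE; apply/spanbP.
Qed.

Lemma lpiB : {morph lpi : u v / u - v}.
Proof. by move=> u v; rewrite [lpi]unlock !piE. Qed.

Definition lscale : K -> lquot -> lquot :=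
  locked_with lscale_key (fun c x => lpi (c *: repr x)).

Lemma lscaleE c v : lscale c (lpi v) = lpi (c *: v).
Proof.
by rewrite [lscale]unlock; apply/lpi_eq; rewrite -scalerBr; apply: span_Z; apply/lpi_eq; rewrite lpiK.
Qed.

HB.instance Definition _ := GRing.isZmodMorphism.Build V lquot lpi lpiB.

Lemma lscaleA a b x : lscale a (lscale b x) = lscale (a * b) x.
Proof. by rewrite -[x]lpiK !lscaleE scalerA. Qed.
Lemma lscale1 : left_id 1 lscale.
Proof. by move=> x; rewrite -[x]lpiK lscaleE scale1r. Qed.
Lemma lscaleDr : right_distributive lscale +%R.
Proof.
by move=> a x y; rewrite -[x]lpiK -[y]lpiK -raddfD !lscaleE scalerDr raddfD.
Qed.
Lemma lscaleDl x : {morph lscale^~ x : a b / a + b}.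
Proof. by move=> a b; rewrite -[x]lpiK !lscaleE scalerDl raddfD. Qed.

HB.instance Definition _ := GRing.Zmodule_isLmodule.Build K lquot
  lscaleA lscale1 lscaleDr lscaleDl.

Lemma lpi_scalable : scalable lpi.
Proof. by move=> c v; rewrite -lscaleE. Qed.
HB.instance Definition _ := GRing.isScalable.Build K V lquot *:%R lpi lpi_scalable.

End LinearQuotient.

Section FreeLinear.
Variables (K : fieldType) (X : choiceType) (V : lmodType K) (f : X -> V).

Definition freelin (g : {malg K[X]}) : V := \sum_(k <- msupp g) g@_k *: f k.

Lemma freelinEw (d : {fset X}) (g : {malg K[X]}) :
  (msupp g `<=` d)%fset -> freelin g = \sum_(k <- d) g@_k *: f k.
Proof.
move=> le; rewrite /freelin; apply: big_fset_incl => // k _ kN.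
by rewrite mcoeff_outdom // scale0r.
Qed.

Lemma freelin_linear : linear freelin.
Proof.
move=> c g h; pose d := (msupp g `|` msupp h `|` msupp (c *: g + h))%fset.
have sg : (msupp g `<=` d)%fset by apply/fsubsetP=> k; rewrite !inE => ->.
have sh : (msupp h `<=` d)%fset.
  by apply/fsubsetP=> k; rewrite !inE => ->; rewrite orbT.
have sgh : (msupp (c *: g + h) `<=` d)%fset.
  by apply/fsubsetP=> k; rewrite !inE => ->; rewrite orbT.
rewrite (freelinEw sg) (freelinEw sh) (freelinEw sgh) scaler_sumr -big_split /=.
by apply: eq_bigr => k _; rewrite mcoeffD mcoeffZ scalerDl scalerA.
Qed.
HB.instance Definition _ :=
  GRing.isLinear.Build K {malg K[X]} V *:%R freelin freelin_linear.

Lemma freelinU k : freelin << k >> = f k.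
Proof.
rewrite (freelinEw (d := [fset k]%fset)) ?msuppU_le //.
by rewrite big_seq_fset1 mcoeffUU scale1r.
Qed.

End FreeLinear.

Lemma malg_lin_ind (K : fieldType) (X : choiceType) (P : {malg K[X]} -> Prop) :
  P 0 -> (forall c g h, P g -> P h -> P (c *: g + h)) -> (forall k, P << k >>) ->
  forall g, P g.
Proof.
move=> P0 PL PU g; rewrite [g]monalgE; elim/big_rec: _ => // k h _ Ph.
have -> : << g@_k *g k >> = g@_k *: << k >> :> {malg K[X]}.
  by apply/malgP => k'; rewrite mcoeffZ !mcoeffU mulrnAr mulr1.
exact: PL.
Qed.

Lemma lin0 (K : fieldType) (U V : lmodType K) (f : U -> V) : linear f -> f 0 = 0.
Proof.
by move=> lf; have := lf (-1) 0 0; rewrite scaler0 addr0 scaleN1r addNr.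
Qed.

Section Tensor.
Variable K : fieldType.

Section Module.
Variables A B : lmodType K.

Local Notation free := {malg K[(A * B)%type]}.

Inductive tensor_rel : free -> Prop :=
| tensor_relDl c a a' b :
    tensor_rel (<< (c *: a + a', b) >> - (c *: << (a, b) >> + << (a', b) >>))
| tensor_relDr c a b b' :
    tensor_rel (<< (a, c *: b + b') >> - (c *: << (a, b) >> + << (a, b') >>)).

Definition tensor := lquot tensor_rel.
HB.instance Definition _ := GRing.Lmodule.on tensor.

(* Locked, as unification would otherwise unfold the quotient. *)
Definition pure : A -> B -> tensor :=
  locked_with pure_key (fun a b => lpi tensor_rel << (a, b) >>).

Lemma pureDl c a a' b : pure (c *: a + a') b = c *: pure a b + pure a' b.
Proof.
rewrite [pure]unlock -linearP; apply/lpi_eq/span_gen; exact: tensor_relDl.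
Qed.
Lemma pureDr c a b b' : pure a (c *: b + b') = c *: pure a b + pure a b'.
Proof.
rewrite [pure]unlock -linearP; apply/lpi_eq/span_gen; exact: tensor_relDr.
Qed.

Lemma tensor_ind (P : tensor -> Prop) :
  P 0 -> (forall c t u, P t -> P u -> P (c *: t + u)) ->
  (forall a b, P (pure a b)) -> forall t, P t.
Proof.
move=> P0 PL PU t; rewrite -[t]lpiK.
elim/malg_lin_ind: (repr t) => [|c g h Pg Ph|[a b]];
  last by have := PU a b; rewrite [pure]unlock.
- by rewrite linear0.
- by rewrite linearP; apply: PL.
Qed.

Definition bilin (V : lmodType K) (f : A -> B -> V) :=
  (forall b, linear (f^~ b)) /\ (forall a, linear (f a)).

(* The linear map a (x) b |-> f a b; this equation, tlift_pure, and linearity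
   only hold when f is bilinear. *)
Definition tlift (V : lmodType K) (f : A -> B -> V) : tensor -> V :=
  locked_with tlift_key (fun t => freelin (fun p => f p.1 p.2) (repr t)).

Lemma tlift_pi (V : lmodType K) (f : A -> B -> V) g : bilin f ->
  tlift f (lpi tensor_rel g) = freelin (fun p => f p.1 p.2) g.
Proof.
move=> [fl fr]; rewrite [tlift f]unlock; apply/eqP; rewrite -subr_eq0 -linearB /=.
have : span tensor_rel (repr (lpi tensor_rel g) - g).
  by apply/lpi_eq; rewrite lpiK.
elim=> [_ []|| u v _ /eqP Hu _ /eqP Hv|c v _ /eqP Hv].
- by move=> c a a' b; rewrite linearB linearP /= !freelinU /= fl subrr.
- by move=> c a b b'; rewrite linearB linearP /= !freelinU /= fr subrr.
- by rewrite linear0.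
- by rewrite linearD /= Hu Hv addr0.
- by rewrite linearZ /= Hv scaler0.
Qed.

Lemma tlift_pure (V : lmodType K) (f : A -> B -> V) a b : bilin f ->
  tlift f (pure a b) = f a b.
Proof. by move=> bf; rewrite [pure]unlock tlift_pi // freelinU. Qed.

Lemma tlift_linear (V : lmodType K) (f : A -> B -> V) : bilin f ->
  linear (tlift f).
Proof.
move=> bf c t u; rewrite -[t]lpiK -[u]lpiK -linearP !tlift_pi //.
by rewrite linearP.
Qed.

Lemma eq_tlift (V : lmodType K) (f g : A -> B -> V) :
  (forall a b, f a b = g a b) -> tlift f =1 tlift g.
Proof. by move=> fg t; rewrite [tlift f]unlock [tlift g]unlock; apply: eq_bigr => k _; rewrite fg. Qed.

Lemma tlift_comb (V : lmodType K) (f g h : A -> B -> V) c t :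
  (forall a b, f a b = c *: g a b + h a b) ->
  tlift f t = c *: tlift g t + tlift h t.
Proof.
move=> fE; rewrite [tlift f]unlock [tlift g]unlock [tlift h]unlock /freelin scaler_sumr -big_split /=.
apply: eq_bigr => k _; rewrite fE scalerDr !scalerA.
by rewrite [c * _]mulrC.
Qed.

End Module.

Definition tmap (A B C D : lmodType K) (f : A -> C) (g : B -> D) :
  tensor A B -> tensor C D := tlift (fun a b => pure (f a) (g b)).

Definition tassoc (A B C : lmodType K) :
    tensor (tensor A B) C -> tensor A (tensor B C) :=
  tlift (fun t c => tlift (fun a b => pure a (pure b c)) t).

Section Algebra.
Variables A B : algType K.
Local Notation T := (tensor A B).

Definition tone : T := pure 1 1.
Definition tmul : T -> T -> T := locked_with tmul_key (fun t u =>
  tlift (fun a b => tlift (fun c d => pure (a * c) (b * d)) u) t).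

Let bilin_in (a : A) (b : B) :
  bilin (fun (c : A) (d : B) => pure (a * c) (b * d) : T).
Proof.
split=> x c y z /=.
  by rewrite mulrDr -scalerAr pureDl.
by rewrite mulrDr -scalerAr pureDr.
Qed.

Let bilin_out (u : T) :
  bilin (fun a b => tlift (fun c d => pure (a * c) (b * d)) u : T).
Proof.
split=> x c y z /=; apply: tlift_comb => a b.
  by rewrite mulrDl -scalerAl pureDl.
by rewrite mulrDl -scalerAl pureDr.
Qed.

Lemma tmul_pure a b c d : tmul (pure a b) (pure c d) = pure (a * c) (b * d).
Proof. by rewrite [tmul]unlock tlift_pure // tlift_pure. Qed.

Lemma tmulPl u : linear (tmul^~ u).
Proof. by rewrite [tmul]unlock; apply: tlift_linear. Qed.

Lemma tmulPr t : linear (tmul t).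
Proof.
move=> c u v; elim/tensor_ind: t => [|d t t' IHt IHt'|a b].
- by rewrite !(lin0 (tmulPl _)) scaler0 addr0.
- by rewrite !tmulPl IHt IHt' !scalerDr !scalerA [d * c]mulrC addrACA.
- by rewrite [tmul]unlock !tlift_pure // tlift_linear.
Qed.

Lemma tmulA : associative (@tmul).
Proof.
move=> t u v; elim/tensor_ind: t => [|k t t' IHt IHt'|a b].
- by rewrite !(lin0 (tmulPl _)).
- by rewrite !tmulPl IHt IHt'.
elim/tensor_ind: u => [|k u u' IHu IHu'|c d].
- by rewrite (lin0 (tmulPl _)) !(lin0 (tmulPr _)) (lin0 (tmulPl _)).
- by rewrite tmulPl !tmulPr tmulPl IHu IHu'.
elim/tensor_ind: v => [|k v v' IHv IHv'|p q].
- by rewrite !(lin0 (tmulPr _)).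
- by rewrite !tmulPr IHv IHv'.
by rewrite !tmul_pure !mulrA.
Qed.

Lemma tmul1t : left_id tone tmul.
Proof.
elim/tensor_ind => [|k u u' IHu IHu'|c d]; first exact: (lin0 (tmulPr _)).
  by rewrite tmulPr IHu IHu'.
by rewrite tmul_pure !mul1r.
Qed.

Lemma tmult1 : right_id tone tmul.
Proof.
elim/tensor_ind => [|k u u' IHu IHu'|c d]; first exact: (lin0 (tmulPl _)).
  by rewrite tmulPl IHu IHu'.
by rewrite tmul_pure !mulr1.
Qed.

Lemma tmulDl : left_distributive tmul +%R.
Proof. by move=> t u v; rewrite -[t]scale1r tmulPl !scale1r. Qed.

Lemma tmulDr : right_distributive tmul +%R.
Proof. by move=> t u v; rewrite -[u]scale1r tmulPr !scale1r. Qed.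

HB.instance Definition _ :=
  GRing.Zmodule_isPzRing.Build T tmulA tmul1t tmult1 tmulDl tmulDr.

End Algebra.
End Tensor.


Section Presented.
Variables (K : fieldType) (X : choiceType).

Local Notation M := {malg K[{fmonom X}]}.

(* The operations are those of M, locked against unification. *)
Definition freealg : Type := M.
HB.instance Definition _ := Choice.on freealg.

Definition fopp : freealg -> freealg :=
  locked_with fopp_key (fun x => - (x : M)).
Definition fadd : freealg -> freealg -> freealg :=
  locked_with fadd_key (fun x y => (x : M) + (y : M)).
Definition fscale : K -> freealg -> freealg :=
  locked_with fscale_key (fun c x => c *: (x : M)).
Definition fmul : freealg -> freealg -> freealg :=
  locked_with fmul_key (fun x y => (x : M) * (y : M)).

Lemma foppE (x : M) : fopp x = - x.
Proof. by rewrite [fopp]unlock. Qed.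
Lemma faddE (x y : M) : fadd x y = x + y.
Proof. by rewrite [fadd]unlock. Qed.
Lemma fscaleE c (x : M) : fscale c x = c *: x.
Proof. by rewrite [fscale]unlock. Qed.
Lemma fmulE (x y : M) : fmul x y = x * y.
Proof. by rewrite [fmul]unlock. Qed.

Lemma malgC_central (c : K) (x : M) : c%:MP * x = x * c%:MP.
Proof.
rewrite [x]monalgE mulr_sumr mulr_suml; apply: eq_bigr => k _.
by rewrite !malgM_def !fgmulUU mul1m mulm1 mulrC.
Qed.

Lemma faddA : associative fadd.
Proof. by move=> x y z; rewrite !faddE; exact: (@addrA M). Qed.
Lemma faddC : commutative fadd.
Proof. by move=> x y; rewrite !faddE; exact: (@addrC M). Qed.
Lemma fadd0 : left_id (0 : M) fadd.
Proof. by move=> x; rewrite faddE; exact: (@add0r M). Qed.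
Lemma faddN : left_inverse (0 : M) fopp fadd.
Proof. by move=> x; rewrite faddE foppE; exact: (@addNr M). Qed.
HB.instance Definition _ :=
  GRing.isZmodule.Build freealg faddA faddC fadd0 faddN.

Lemma fscaleA a b x : fscale a (fscale b x) = fscale (a * b) x.
Proof. by rewrite !fscaleE; exact: (@scalerA _ M). Qed.
Lemma fscale1 : left_id 1 fscale.
Proof. by move=> x; rewrite fscaleE; exact: (@scale1r _ M). Qed.
Lemma fscaleDr : right_distributive fscale fadd.
Proof. by move=> c x y; rewrite !faddE !fscaleE; exact: (@scalerDr _ M). Qed.
Lemma fscaleDl x : {morph fscale^~ x : a b / a + b >-> fadd a b}.
Proof. by move=> c d; rewrite !faddE !fscaleE; exact: (@scalerDl _ M). Qed.
HB.instance Definition _ := GRing.Zmodule_isLmodule.Build K freealg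
  fscaleA fscale1 fscaleDr fscaleDl.

Lemma fmulA : associative fmul.
Proof. by move=> x y z; rewrite !fmulE; exact: (@mulrA M). Qed.
Lemma fmul1 : left_id (1 : M) fmul.
Proof. by move=> x; rewrite fmulE; exact: (@mul1r M). Qed.
Lemma fmulr1 : right_id (1 : M) fmul.
Proof. by move=> x; rewrite fmulE; exact: (@mulr1 M). Qed.
Lemma fmulDl : left_distributive fmul fadd.
Proof. by move=> x y z; rewrite !faddE !fmulE; exact: (@mulrDl M). Qed.
Lemma fmulDr : right_distributive fmul fadd.
Proof. by move=> x y z; rewrite !faddE !fmulE; exact: (@mulrDr M). Qed.
Lemma fone_neq0 : (1 : M) != 0.
Proof. exact: oner_neq0. Qed.
HB.instance Definition _ := GRing.Zmodule_isNzRing.Build freealg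
  fmulA fmul1 fmulr1 fmulDl fmulDr fone_neq0.

Lemma freealg_scalerAl (c : K) (x y : freealg) : c *: (x * y) = c *: x * y.
Proof.
rewrite -[LHS]/(fscale c (fmul x y)) -[RHS]/(fmul (fscale c x) y).
by rewrite !fmulE !fscaleE; exact: (@scalerAl _ M).
Qed.
HB.instance Definition _ :=
  GRing.LSemiModule_isLSemiAlgebra.Build K freealg freealg_scalerAl.

Lemma freealg_scalerAr (c : K) (x y : freealg) : c *: (x * y) = x * (c *: y).
Proof.
rewrite -[LHS]/(fscale c (fmul x y)) -[RHS]/(fmul x (fscale c y)).
rewrite !fmulE !fscaleE -[LHS]mul_malgC -[in RHS]mul_malgC.
by rewrite [LHS](@mulrA M) [RHS](@mulrA M) malgC_central.
Qed.
HB.instance Definition _ :=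
  GRing.LSemiAlgebra_isSemiAlgebra.Build K freealg freealg_scalerAr.

Definition fgen : X -> freealg :=
  locked_with fgen_key (fun x => << fmu x >> : M).
Lemma fgenE x : fgen x = (<< fmu x >> : M).
Proof. by rewrite [fgen]unlock. Qed.

Variable R : freealg -> Prop.

Definition ideal_gen : freealg -> Prop :=
  fun v => exists a x b : freealg, R x /\ v = a * x * b.

(* K<X> modulo the two-sided ideal generated by R *)
Definition presented := lquot ideal_gen.
HB.instance Definition _ := GRing.Lmodule.on presented.

Definition ppi (x : freealg) : presented := lpi ideal_gen x.
Definition pgen (x : X) : presented := ppi (fgen x).

Lemma ideal_mull (a v : freealg) : span ideal_gen v -> span ideal_gen (a * v).
Proof.
elim=> [_ [b [x [d [Rx ->]]]]||u w _ IHu _ IHw|c w _ IHw].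
- by apply: span_gen; exists (a * b), x, d; rewrite !mulrA.
- by rewrite mulr0; apply: span_0.
- by rewrite mulrDr; apply: span_D.
- by rewrite -scalerAr; apply: span_Z.
Qed.

Lemma ideal_mulr (a v : freealg) : span ideal_gen v -> span ideal_gen (v * a).
Proof.
elim=> [_ [b [x [d [Rx ->]]]]||u w _ IHu _ IHw|c w _ IHw].
- by apply: span_gen; exists b, x, (d * a); rewrite !mulrA.
- by rewrite mul0r; apply: span_0.
- by rewrite mulrDl; apply: span_D.
- by rewrite -scalerAl; apply: span_Z.
Qed.

Definition pone : presented := ppi 1.
Definition pmul : presented -> presented -> presented :=
  locked_with pmul_key (fun x y => ppi (repr x * repr y)).

Lemma pmulE x y : pmul (ppi x) (ppi y) = ppi (x * y).
Proof.
rewrite [pmul]unlock; apply/lpi_eq.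
set x' := repr (ppi x); set y' := repr (ppi y).
have -> : x' * y' - x * y = x' * (y' - y) + (x' - x) * y.
  by rewrite mulrBr mulrBl addrA subrK.
by apply: span_D; [apply: ideal_mull | apply: ideal_mulr]; apply/lpi_eq/lpiK.
Qed.

Lemma ppiK (x : presented) : ppi (repr x) = x. Proof. exact: lpiK. Qed.
Lemma ppi_linear : linear ppi. Proof. exact: linearP. Qed.
HB.instance Definition _ :=
  GRing.isLinear.Build K freealg presented *:%R ppi ppi_linear.

Lemma pmulA : associative pmul.
Proof.
by move=> x y z; rewrite -[x]ppiK -[y]ppiK -[z]ppiK !pmulE mulrA.
Qed.
Lemma pmul1 : left_id pone pmul.
Proof. by move=> x; rewrite -[x]ppiK pmulE mul1r. Qed.
Lemma pmulr1 : right_id pone pmul.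
Proof. by move=> x; rewrite -[x]ppiK pmulE mulr1. Qed.
Lemma pmulDl : left_distributive pmul +%R.
Proof.
move=> x y z; rewrite -[x]ppiK -[y]ppiK -[z]ppiK -linearD !pmulE mulrDl.
by rewrite linearD.
Qed.
Lemma pmulDr : right_distributive pmul +%R.
Proof.
move=> x y z; rewrite -[x]ppiK -[y]ppiK -[z]ppiK -linearD !pmulE mulrDr.
by rewrite linearD.
Qed.
HB.instance Definition _ := GRing.Zmodule_isPzRing.Build presented
  pmulA pmul1 pmulr1 pmulDl pmulDr.

Lemma ppi_monoid_morphism : monoid_morphism ppi.
Proof. by split=> // x y; rewrite -pmulE. Qed.
HB.instance Definition _ :=
  GRing.isMonoidMorphism.Build freealg presented ppi ppi_monoid_morphism.

Lemma presented_scalerAl c (x y : presented) : c *: (x * y) = c *: x * y.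
Proof.
by rewrite -[x]ppiK -[y]ppiK -linearZ -!rmorphM -linearZ scalerAl.
Qed.
Lemma presented_scalerAr c (x y : presented) : c *: (x * y) = x * (c *: y).
Proof.
by rewrite -[x]ppiK -[y]ppiK -linearZ -!rmorphM -linearZ scalerAr.
Qed.

Section Evaluation.
Variable chi : X -> K.

Definition fmonom_eval (m : fmonom X) : K := \prod_(x <- (m : seq X)) chi x.
Lemma fmonom_eval_mmorphism : mmorphism fmonom_eval.
Proof.
split=> [m m'|]; rewrite /fmonom_eval; first by rewrite fmM big_cat.
by rewrite fm1 big_nil.
Qed.
HB.instance Definition _ :=
  isMultiplicative.Build (fmonom X) K fmonom_eval fmonom_eval_mmorphism.

Definition feval : freealg -> K :=
  locked_with feval_key (fun x : M => mmap idfun fmonom_eval x).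

Lemma fevalE (x : M) : feval x = mmap idfun fmonom_eval x.
Proof. by rewrite [feval]unlock. Qed.

Lemma feval_zmod_morphism : zmod_morphism feval.
Proof. move=> x y; rewrite -[x - y]/(fadd x (fopp y)) faddE foppE !fevalE.
exact: mmapB. Qed.
HB.instance Definition _ :=
  GRing.isZmodMorphism.Build freealg K feval feval_zmod_morphism.

Lemma feval_monoid_morphism : monoid_morphism feval.
Proof.
split=> [|x y]; first by rewrite fevalE; exact: mmap1.
rewrite -[x * y]/(fmul x y) fmulE !fevalE.
exact: (mmap_is_multiplicative (f := idfun) (h := fmonom_eval)).1.
Qed.
HB.instance Definition _ :=
  GRing.isMonoidMorphism.Build freealg K feval feval_monoid_morphism.

Lemma fevalZ : scalable_for *%R feval.
Proof.
move=> c x; rewrite -[c *: x]/(fscale c x) fscaleE !fevalE.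
exact: mmap_is_linear.
Qed.

Lemma fevalB (x y : freealg) : feval (x - y) = feval x - feval y.
Proof. exact: rmorphB. Qed.
Lemma fevalD (x y : freealg) : feval (x + y) = feval x + feval y.
Proof. exact: rmorphD. Qed.
Lemma fevalM (x y : freealg) : feval (x * y) = feval x * feval y.
Proof. exact: rmorphM. Qed.
Lemma feval1 : feval 1 = 1.
Proof. exact: rmorph1. Qed.

Lemma feval_gen x : feval (fgen x) = chi x.
Proof.
by rewrite fgenE fevalE mmapU mul1r /= /fmonom_eval fmU big_seq1.
Qed.

(* algType demands 1 != 0, which is the case as soon as the relators vanish
   under some evaluation in K. *)
Lemma presented_oner_neq0 :
  (forall x, R x -> feval x = 0) -> 1 != 0 :> presented.
Proof.
move=> R0; apply/eqP => E; have {E} /lpi_eq : ppi 1 = ppi 0.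
  by rewrite rmorph1 linear0.
rewrite subr0 => I1.
suff /eqP : feval 1 = 0 by rewrite rmorph1 oner_eq0.
elim: I1 => [_ [a [x [b [Rx ->]]]]||u w _ IHu _ IHw|c w _ IHw].
- by rewrite !rmorphM /= (R0 _ Rx) mulr0 mul0r.
- exact: rmorph0.
- by rewrite rmorphD /= IHu IHw addr0.
- by rewrite fevalZ IHw mulr0.
Qed.

End Evaluation.

End Presented.

Section HopfAlgebra.
Variable K : fieldType.

Record hopf_alg (A : algType K) := HopfAlg {
  comul : {lrmorphism A -> tensor A A};
  counit : {lrmorphism A -> K | *%R};
  antipode : {linear A -> A};
  comulA : forall x,
    tassoc (tmap comul idfun (comul x)) = tmap idfun comul (comul x);
  counitl : forall x, tlift (fun a b => counit a *: b) (comul x) = x;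
  counitr : forall x, tlift (fun a b => counit b *: a) (comul x) = x;
  antipodel : forall x, tlift (fun a b => antipode a * b) (comul x) = (counit x)%:A;
  antipoder : forall x, tlift (fun a b => a * antipode b) (comul x) = (counit x)%:A
}.

Definition grouplike (A : algType K) (H : hopf_alg A) (g : A) :=
  comul H g = pure g g /\ counit H g = 1.

Definition hopf_morphism (A B : algType K) (HA : hopf_alg A) (HB : hopf_alg B)
    (phi : {lrmorphism A -> B}) :=
  [/\ forall x, comul HB (phi x) = tmap phi phi (comul HA x),
      forall x, counit HB (phi x) = counit HA x &
      forall x, antipode HB (phi x) = phi (antipode HA x)].

End HopfAlgebra.

Arguments comul {K A} h.
Arguments counit {K A} h.
Arguments antipode {K A} h.

(* Indices are 0-based: (i : 'I_n) is the index i + 1 of epsilon, a, b, K, L, and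
   (j : 'I_n.-1) the index j + 1 of alpha, e, f, E, F. For such a j, lo j and
   hi j are the indices j and j + 1 as elements of 'I_n. *)
Section Indices.
Variable n : nat.

Lemma lo_proof (j : 'I_n.-1) : (j < n)%N.
Proof. by case: n j => [|m] [j lt] //=; apply: ltnW. Qed.
Lemma hi_proof (j : 'I_n.-1) : (j.+1 < n)%N.
Proof. by case: n j => [|m] [j lt]. Qed.

Definition lo (j : 'I_n.-1) : 'I_n := Ordinal (lo_proof j).
Definition hi (j : 'I_n.-1) : 'I_n := Ordinal (hi_proof j).

(* The vectors involved lie in the lattice Z^n of R^n; working there makes the
   exponents <epsilon_i, alpha_j> integers. *)
Definition eps (i : 'I_n) : 'rV[int]_n := delta_mx 0 i.
Definition alpha (j : 'I_n.-1) : 'rV[int]_n := eps (lo j) - eps (hi j).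
Definition inner (u v : 'rV[int]_n) : int := (u *m v^T) 0 0.

End Indices.

Definition kron (x y : nat) : int := (x == y)%N.

(* The suffix V marks the inverse of a torus generator. *)
Variant Ugen (n : nat) : Type :=
| Ue of 'I_n.-1 | Uf of 'I_n.-1 | Ua of 'I_n | UaV of 'I_n | Ub of 'I_n | UbV of 'I_n.
HB.instance Definition _ n := gen_eqMixin (Ugen n).
HB.instance Definition _ n := gen_choiceMixin (Ugen n).

Definition Ugens n : choiceType := Choice.clone (Ugen n) _.

Definition Utoral n (g : Ugen n) : bool :=
  match g with Ue _ | Uf _ => false | _ => true end.

Section Urs.
Variables (K : fieldType) (n : nat) (r s : K).

Section Relations.
Local Notation F := (freealg K (Ugens n)).
Local Notation gen := (@fgen K (Ugens n)).
Local Notation e j := (gen (Ue j)).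
Local Notation f j := (gen (Uf j)).
Local Notation a i := (gen (Ua i)).
Local Notation aV i := (gen (UaV i)).
Local Notation b i := (gen (Ub i)).
Local Notation bV i := (gen (UbV i)).

(* x stands for the relation x = 0. *)
Inductive Urel : F -> Prop :=
| R1_comm g h : Utoral g -> Utoral h -> Urel (gen g * gen h - gen h * gen g)
| R1_a (i : 'I_n) : Urel (a i * aV i - 1)
| R1_b (i : 'I_n) : Urel (b i * bV i - 1)
| R2_e (i : 'I_n) (j : 'I_n.-1) : Urel (a i * e j - r ^ inner (eps i) (alpha j) *: (e j * a i))
| R2_f (i : 'I_n) (j : 'I_n.-1) : Urel (a i * f j - r ^ (- inner (eps i) (alpha j)) *: (f j * a i))
| R3_e (i : 'I_n) (j : 'I_n.-1) : Urel (b i * e j - s ^ inner (eps i) (alpha j) *: (e j * b i))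
| R3_f (i : 'I_n) (j : 'I_n.-1) : Urel (b i * f j - s ^ (- inner (eps i) (alpha j)) *: (f j * b i))
| R4 (i j : 'I_n.-1) :
    Urel (e i * f j - f j * e i -
          ((i == j)%:R / (r - s)) *: (a (lo i) * b (hi i) - a (hi i) * b (lo i)))
| R5_e (i j : 'I_n.-1) : (1 < `|i%:Z - j%:Z|)%N -> Urel (e i * e j - e j * e i)
| R5_f (i j : 'I_n.-1) : (1 < `|i%:Z - j%:Z|)%N -> Urel (f i * f j - f j * f i)
| R6_l (i j : 'I_n.-1) : j = i.+1 :> nat ->
    Urel (e i ^+ 2 * e j - (r + s) *: (e i * e j * e i) + (r * s) *: (e j * e i ^+ 2))
| R6_r (i j : 'I_n.-1) : j = i.+1 :> nat ->
    Urel (e i * e j ^+ 2 - (r + s) *: (e j * e i * e j) + (r * s) *: (e j ^+ 2 * e i))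
| R7_l (i j : 'I_n.-1) : j = i.+1 :> nat ->
    Urel (f i ^+ 2 * f j - (r^-1 + s^-1) *: (f i * f j * f i)
          + (r^-1 * s^-1) *: (f j * f i ^+ 2))
| R7_r (i j : 'I_n.-1) : j = i.+1 :> nat ->
    Urel (f i * f j ^+ 2 - (r^-1 + s^-1) *: (f j * f i * f j)
          + (r^-1 * s^-1) *: (f j ^+ 2 * f i)).
End Relations.

Definition Urs := presented Urel.
HB.instance Definition _ := GRing.Lmodule.on Urs.
HB.instance Definition _ := GRing.PzRing.on Urs.

Lemma Urs_oner_neq0 : 1 != 0 :> Urs.
Proof.
pose chi (g : Ugens n) : K := (Utoral g)%:R.
apply: (@presented_oner_neq0 _ _ _ chi) => x.
case=> *; rewrite ?expr2; rewrite !(fevalB, fevalD, fevalM, fevalZ, feval1, feval_gen);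
  do ?[move: (r ^ _) => ? | move: (s ^ _) => ? | move: (_ / _) => ?];
  rewrite /chi /= ?(mul0r, mulr0, mul1r, mulr1, subrr, subr0, addr0) //.
by rewrite mulrC subrr.
Qed.
HB.instance Definition _ := GRing.PzSemiRing_isNonZero.Build Urs Urs_oner_neq0.
HB.instance Definition _ := GRing.LSemiModule_isLSemiAlgebra.Build K Urs
  (@presented_scalerAl K (Ugens n) Urel).
HB.instance Definition _ := GRing.LSemiAlgebra_isSemiAlgebra.Build K Urs
  (@presented_scalerAr K (Ugens n) Urel).

Local Notation gen g := (@pgen K (Ugens n) Urel g).
Definition ue (j : 'I_n.-1) : Urs := gen (Ue j).
Definition uf (j : 'I_n.-1) : Urs := gen (Uf j).
Definition ua (i : 'I_n) : Urs := gen (Ua i).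
Definition uaV (i : 'I_n) : Urs := gen (UaV i).
Definition ub (i : 'I_n) : Urs := gen (Ub i).
Definition ubV (i : 'I_n) : Urs := gen (UbV i).

Definition omega j : Urs := ua (lo j) * ub (hi j).
Definition omegaV j : Urs := uaV (lo j) * ubV (hi j).
Definition omega' j : Urs := ua (hi j) * ub (lo j).
Definition omega'V j : Urs := uaV (hi j) * ubV (lo j).

(* The comultiplication is an algebra morphism, so its values on the generators
   determine it, and with it the counit and the antipode. *)
Record is_Urs_hopf (H : hopf_alg Urs) : Prop := {
  Urs_grouplike : forall i,
    [/\ grouplike H (ua i), grouplike H (uaV i),
        grouplike H (ub i) & grouplike H (ubV i)];
  Urs_comul_e : forall i, comul H (ue i) = pure (ue i) 1 + pure (omega i) (ue i);
  Urs_comul_f : forall i, comul H (uf i) = pure 1 (uf i) + pure (uf i) (omega' i);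
  Urs_counit_e : forall i, counit H (ue i) = 0;
  Urs_counit_f : forall i, counit H (uf i) = 0;
  Urs_antipode_e : forall i, antipode H (ue i) = - (omegaV i * ue i);
  Urs_antipode_f : forall i, antipode H (uf i) = - (uf i * omega'V i)
}.

End Urs.

Variant Hgen (n : nat) : Type :=
| HE of 'I_n.-1 | HF of 'I_n.-1 | HK of 'I_n | HKV of 'I_n | HL of 'I_n | HLV of 'I_n.
HB.instance Definition _ n := gen_eqMixin (Hgen n).
HB.instance Definition _ n := gen_choiceMixin (Hgen n).

Definition Hgens n : choiceType := Choice.clone (Hgen n) _.

Definition Htoral n (g : Hgen n) : bool :=
  match g with HE _ | HF _ => false | _ => true end.

Section Uhat.
Variables (k : fieldType) (n : nat) (r s : k).

Section Relations.
Local Notation A := (freealg k (Hgens n)).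
Local Notation gen := (@fgen k (Hgens n)).
Local Notation E j := (gen (HE j)).
Local Notation F j := (gen (HF j)).
Local Notation K i := (gen (HK i)).
Local Notation KV i := (gen (HKV i)).
Local Notation L i := (gen (HL i)).
Local Notation LV i := (gen (HLV i)).

(* The left adjoint actions of E_i and F_i, already at the level of the free
   algebra, where they are needed to state the Serre relations. *)
Definition adE (i : 'I_n.-1) (x : A) : A :=
  E i * x - L (hi i) * LV (lo i) * x * L (lo i) * LV (hi i) * E i.
Definition adF (i : 'I_n.-1) (x : A) : A :=
  F i * x - K (hi i) * KV (lo i) * x * K (lo i) * KV (hi i) * F i.

(* 1 - <alpha_i, alpha_j> >= 1 for i <> j, so the absolute value is harmless. *)
Definition serre_exponent (i j : 'I_n.-1) : nat :=
  `|1 - inner (alpha i) (alpha j)|%N.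

(* delta_{i,j-1} is written kron i.+1 j, as subtraction on nat truncates. *)
Inductive Hrel : A -> Prop :=
| H_comm g h : Htoral g -> Htoral h -> Hrel (gen g * gen h - gen h * gen g)
| H_K (i : 'I_n) : Hrel (K i * KV i - 1)
| H_L (i : 'I_n) : Hrel (L i * LV i - 1)
| H_KE (i : 'I_n.-1) (j : 'I_n) :
    Hrel (K j * E i - (r ^ (- kron i j) * s ^ (- kron i.+1 j)) *: (E i * K j))
| H_KF (i : 'I_n.-1) (j : 'I_n) :
    Hrel (K j * F i - (r ^ kron i j * s ^ kron i.+1 j) *: (F i * K j))
| H_LE (i : 'I_n.-1) (j : 'I_n) :
    Hrel (L j * E i - (r ^ kron i.+1 j * s ^ kron i j) *: (E i * L j))
| H_LF (i : 'I_n.-1) (j : 'I_n) :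
    Hrel (L j * F i - (r ^ (- kron i.+1 j) * s ^ (- kron i j)) *: (F i * L j))
| H_EF (i : 'I_n.-1) :
    Hrel (E i * F i - (r^-1 * s) *: (F i * E i)
          - (r^-1 * s - 1) *: (L (hi i) * K (hi i) * LV (lo i) * KV (lo i) - 1))
| H_EF' (i j : 'I_n.-1) : i != j ->
    Hrel (E i * F j - (r ^ kron i j.+1 * s ^ (- kron i.+1 j)) *: (F j * E i))
| H_adE (i j : 'I_n.-1) : i != j ->
    Hrel (iter (serre_exponent i j) (adE i) (E j))
| H_adF (i j : 'I_n.-1) : i != j ->
    Hrel (iter (serre_exponent i j) (adF i) (F j)).
End Relations.

Definition Uhat := presented Hrel.
HB.instance Definition _ := GRing.Lmodule.on Uhat.
HB.instance Definition _ := GRing.PzRing.on Uhat.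

Lemma Uhat_oner_neq0 : 1 != 0 :> Uhat.
Proof.
pose chi (g : Hgens n) : k := (Htoral g)%:R.
have ev_iter (ad : freealg k (Hgens n) -> freealg k (Hgens n)) m x :
    (forall y, feval chi (ad y) = 0) -> feval chi x = 0 ->
    feval chi (iter m ad x) = 0.
  by case: m => [|m] //= ad0 _.
apply: (@presented_oner_neq0 _ _ _ chi) => x.
case=> [|||||||||i j _|i j _] *; first [apply: ev_iter => [y|] | idtac];
  rewrite ?/adE ?/adF !(fevalB, fevalD, fevalM, fevalZ, feval1, feval_gen);
  do ?[move: (r ^ _) => ? | move: (s ^ _) => ? | move: (r^-1 * _ - _) => ?];
  rewrite /chi /= ?(mul0r, mulr0, mul1r, mulr1, subrr, subr0, addr0) //.
by rewrite mulrC subrr.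
Qed.
HB.instance Definition _ := GRing.PzSemiRing_isNonZero.Build Uhat Uhat_oner_neq0.
HB.instance Definition _ := GRing.LSemiModule_isLSemiAlgebra.Build k Uhat
  (@presented_scalerAl k (Hgens n) Hrel).
HB.instance Definition _ := GRing.LSemiAlgebra_isSemiAlgebra.Build k Uhat
  (@presented_scalerAr k (Hgens n) Hrel).

Local Notation gen g := (@pgen k (Hgens n) Hrel g).
Definition hE (j : 'I_n.-1) : Uhat := gen (HE j).
Definition hF (j : 'I_n.-1) : Uhat := gen (HF j).
Definition hK (i : 'I_n) : Uhat := gen (HK i).
Definition hKV (i : 'I_n) : Uhat := gen (HKV i).
Definition hL (i : 'I_n) : Uhat := gen (HL i).
Definition hLV (i : 'I_n) : Uhat := gen (HLV i).

Record is_Uhat_hopf (H : hopf_alg Uhat) : Prop := {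
  Uhat_grouplike : forall i,
    [/\ grouplike H (hK i), grouplike H (hKV i),
        grouplike H (hL i) & grouplike H (hLV i)];
  Uhat_comul_E : forall i,
    comul H (hE i) = pure (hE i) 1 + pure (hL (hi i) * hLV (lo i)) (hE i);
  Uhat_comul_F : forall i,
    comul H (hF i) = pure (hF i) 1 + pure (hK (hi i) * hKV (lo i)) (hF i)
}.

End Uhat.

(* Main.v *)
(** The proposed images of the generators satisfy the relations of [Uhat].  A torus
    generator acts on [e_j] and [f_j] by a product of powers of [r] and [s] that
    telescopes to the required one, and the ratios [L_(i+1) L_i^-1] and
    [K_(i+1) K_i^-1] go to [omega_i] and [omega'_i^-1].  Hence [ad(E_i)] becomes a
    scaled twisted commutator with [e_i], and [ad(F_i)] becomes
    [x |-> omega'_i^-1 [f_i, x]], so that both Serre relations reduce to (R6) and (R7)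
    up to a scalar and a torus factor.  Compatibility with the coproduct is checked
    on generators; that with the antipode is then automatic. *)
From HB Require Import structures.
Require Import Defs.
From mathcomp Require Import all_boot all_order all_algebra zify ring.
From mathcomp Require Import monalg.

Set Implicit Arguments.
Unset Strict Implicit.
Unset Printing Implicit Defensive.

Import GRing.Theory.
Local Open Scope ring_scope.

(** * Presented algebras *)

Section UniversalProperty.
Variables (K : fieldType) (X : choiceType).

Definition word (m : fmonom X) : freealg K X := (<< m >> : {malg K[{fmonom X}]}).

Lemma word_cons x m : word (mmul (fmu x) m) = fgen K x * word m.
Proof.
rewrite -[RHS]/(fmul _ _) fmulE fgenE malgM_def.
by rewrite fgmulUU mulr1.
Qed.

Lemma fmonom_ind (P : fmonom X -> Prop) :
  P mone -> (forall x m, P m -> P (mmul (fmu x) m)) -> forall m, P m.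
Proof.
move=> P1 PM [s]; elim: s => [|x s IH].
  by have -> : FMonom [::] = mone :> fmonom X by apply/eqP; rewrite fmP fm1.
suff -> : FMonom (x :: s) = mmul (fmu x) (FMonom s) by exact: PM.
by apply/eqP; rewrite fmP fmM fmU.
Qed.

Lemma freealg_word_ind (P : freealg K X -> Prop) :
  P 0 -> (forall c x y, P x -> P y -> P (c *: x + y)) ->
  (forall m, P (word m)) -> forall y, P y.
Proof.
move=> P0 PL PW; apply: malg_lin_ind => // c x y Px Py.
by have := PL c _ _ Px Py; rewrite -[_ + _]/(fadd (fscale c x) y) faddE fscaleE.
Qed.

(** Words grow by one letter on the left, so closure under left multiplication by generators reaches
    every monomial. *)
Lemma freealg_ind (P : freealg K X -> Prop) :
  P 1 -> (forall c x y, P x -> P y -> P (c *: x + y)) ->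
  (forall x y, P y -> P (fgen K x * y)) -> forall y, P y.
Proof.
(* The zero case is recovered from the unit as [-1 *: 1 + 1]. *)
move=> P1 PL PM; have P0 : P 0.
  by rewrite -(subrr 1) addrC -scaleN1r; apply: PL.
apply: freealg_word_ind => //; elim/fmonom_ind => [|x m Pm] //.
by rewrite word_cons; apply: PM.
Qed.

Lemma presented_ind (R : freealg K X -> Prop) (P : presented R -> Prop) :
  P 1 -> (forall c x y, P x -> P y -> P (c *: x + y)) ->
  (forall x y, P y -> P (pgen R x * y)) -> forall y, P y.
Proof.
move=> P1 PL PM y; rewrite -[y]ppiK; elim/freealg_ind: (repr y) => [|c x z Px Pz|x z Pz].
- by rewrite rmorph1.
- by rewrite linearP; apply: PL.
- by rewrite rmorphM; apply: PM.
Qed.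

Variables (A : algType K) (h : X -> A).

Definition word_image (m : fmonom X) : A := \prod_(x <- (m : seq X)) h x.

(** The linear extension of [word_image]; multiplicativity is proved afterwards by peeling letters
    off the left factor. *)
Definition extend (x : freealg K X) : A := freelin word_image x.

Lemma extend_linear : linear extend.
Proof.
move=> c x y; rewrite -[_ + _ in LHS]/(fadd (fscale c x) y) faddE fscaleE.
exact: freelin_linear.
Qed.
HB.instance Definition _ :=
  GRing.isLinear.Build K (freealg K X) A *:%R extend extend_linear.

Lemma extend_word m : extend (word m) = word_image m.
Proof. exact: freelinU. Qed.

Lemma extend_gen x : extend (fgen K x) = h x.
Proof. by rewrite fgenE [LHS]freelinU /word_image fmU big_seq1. Qed.

Lemma extend1 : extend 1 = 1.
Proof. by rewrite [LHS]extend_word /word_image fm1 big_nil. Qed.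

Lemma extend_consM x y : extend (fgen K x * y) = h x * extend y.
Proof.
elim/freealg_word_ind: y => [|c y z IHy IHz|m].
- by rewrite mulr0 linear0 mulr0.
- by rewrite mulrDr -scalerAr !linearP /= IHy IHz mulrDr -scalerAr.
- by rewrite -word_cons !extend_word /word_image fmM fmU big_cat big_seq1.
Qed.

Lemma extend_monoid_morphism : monoid_morphism extend.
Proof.
split=> [|x y]; first exact: extend1.
elim/freealg_ind: x => [|c x z IHx IHz|x z IHz].
- by rewrite extend1 !mul1r.
- by rewrite mulrDl -scalerAl !linearP /= IHx IHz mulrDl -scalerAl.
- by rewrite -mulrA !extend_consM IHz mulrA.
Qed.
HB.instance Definition _ :=
  GRing.isMonoidMorphism.Build (freealg K X) A extend extend_monoid_morphism.

Lemma extendB x y : extend (x - y) = extend x - extend y.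
Proof. exact: linearB. Qed.
Lemma extendZ c x : extend (c *: x) = c *: extend x.
Proof. exact: linearZ. Qed.
Lemma extendM x y : extend (x * y) = extend x * extend y.
Proof. exact: rmorphM. Qed.

Variable R : freealg K X -> Prop.

(** The map is computed on representatives. Since [extend] is multiplicative and kills the relators,
    it kills the whole ideal, so the choice of representative is immaterial. *)
Lemma presented_morphism : (forall x, R x -> extend x = 0) ->
  exists f : presented R -> A,
    [/\ linear f, monoid_morphism f & forall x, f (pgen R x) = h x].
Proof.
move=> R0; pose f (x : presented R) := extend (repr x).
have fE x : f (ppi R x) = extend x.
  apply/eqP; rewrite -subr_eq0 -linearB /=.
  have : Defs.span (ideal_gen R) (repr (ppi R x) - x) by apply/lpi_eq; exact: ppiK.
  elim=> [_ [a [y [b [Ry ->]]]]||u w _ /eqP IHu _ /eqP IHw|c w _ /eqP IHw].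
  - by rewrite !rmorphM /= (R0 _ Ry) mulr0 mul0r.
  - by rewrite linear0.
  - by rewrite linearD /= IHu IHw addr0.
  - by rewrite linearZ /= IHw scaler0.
exists f; split=> [c x y||x].
- by rewrite -[x]ppiK -[y]ppiK -linearP !fE linearP.
- split=> [|x y]; first by rewrite -[1]/(ppi R 1) fE extend1.
  by rewrite -[x]ppiK -[y]ppiK -rmorphM !fE rmorphM.
- by rewrite /pgen fE extend_gen.
Qed.

End UniversalProperty.

(** * Tensor products and Hopf algebras *)

Section TensorMaps.
Variable K : fieldType.

Lemma eq_tensor (A B V : lmodType K) (f g : tensor A B -> V) :
  linear f -> linear g -> (forall a b, f (pure a b) = g (pure a b)) -> f =1 g.
Proof.
move=> lf lg fg; elim/tensor_ind => [|c t u IHt IHu|//]; first by rewrite !lin0.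
by rewrite lf lg IHt IHu.
Qed.

Lemma tlift_comp (A B V W : lmodType K) (f : V -> W) (g : A -> B -> V) t :
  linear f -> bilin g -> f (tlift g t) = tlift (fun a b => f (g a b)) t.
Proof.
move=> lf bg; have bfg : bilin (fun a b => f (g a b)).
  by split=> a c u v; rewrite ?bg.1 ?bg.2 lf.
move: t; apply: eq_tensor => [c u v|c u v|a b]; last by rewrite !tlift_pure.
  by rewrite (tlift_linear bg) lf.
exact: tlift_linear.
Qed.

Section Map.
Variables (A B C D : lmodType K) (f : A -> C) (g : B -> D).
Hypotheses (lf : linear f) (lg : linear g).

Lemma bilin_tmap : bilin (fun a b => pure (f a) (g b)).
Proof.
by split=> x c y z; rewrite ?lf ?lg ?pureDl ?pureDr.
Qed.

Lemma tmap_linear : linear (tmap f g).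
Proof. exact/tlift_linear/bilin_tmap. Qed.

Lemma tmap_pure a b : tmap f g (pure a b) = pure (f a) (g b).
Proof. by apply: tlift_pure bilin_tmap. Qed.

Lemma tlift_tmap (V : lmodType K) (h : C -> D -> V) : bilin h ->
  forall t, tlift h (tmap f g t) = tlift (fun a b => h (f a) (g b)) t.
Proof.
move=> bh; have bhfg : bilin (fun a b => h (f a) (g b)).
  by split=> x c y z; rewrite ?lf ?lg ?bh.1 ?bh.2.
apply: eq_tensor => [c t u||a b].
- by rewrite tmap_linear (tlift_linear bh).
- exact: tlift_linear.
- by rewrite tmap_pure !tlift_pure.
Qed.

End Map.

Section Assoc.
Variables (A B C V : lmodType K) (h : A -> tensor B C -> V).
Hypothesis bh : bilin h.

Lemma bilin_pure_inner c : bilin (fun (a : A) (b : B) => h a (pure b c)).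
Proof. by split=> x k y z; rewrite ?pureDl ?bh.1 ?bh.2. Qed.

Lemma bilin_tlift_inner :
  bilin (fun u (c : C) => tlift (fun (a : A) (b : B) => h a (pure b c)) u).
Proof.
split=> [c|u]; first exact/tlift_linear/bilin_pure_inner.
by move=> k y z; apply: tlift_comb => a b; rewrite pureDr bh.2.
Qed.

End Assoc.

Lemma bilin_pure (A B : lmodType K) : bilin (fun (a : A) (b : B) => pure a b).
Proof. by split=> x k y z; rewrite ?pureDl ?pureDr. Qed.

(** Both sides are linear in [t] and then in its left factor, so comparison on [pure (pure a b) c]
    suffices. Coassociativity enters the antipode argument in this form. *)
Lemma tlift_tassoc (A B C V : lmodType K) (h : A -> tensor B C -> V) :
  bilin h -> forall t, tlift h (tassoc t) =
    tlift (fun u c => tlift (fun a b => h a (pure b c)) u) t.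
Proof.
move=> bh.
have bp := @bilin_pure A (tensor B C).
have bpp := bilin_tlift_inner bp; have bhp := bilin_tlift_inner bh.
apply: eq_tensor => [k t u||u c].
- by rewrite [tassoc _](tlift_linear bpp) (tlift_linear bh).
- exact: tlift_linear.
rewrite /tassoc !tlift_pure //; move: u; apply: eq_tensor => [k t u||a b].
- by rewrite (tlift_linear (bilin_pure_inner bp c)) (tlift_linear bh).
- exact/tlift_linear/bilin_pure_inner.
- rewrite !tlift_pure //; first exact: (bilin_pure_inner bh).
  exact: (bilin_pure_inner bp).
Qed.

Lemma pureM (A B : algType K) (a c : A) (b d : B) :
  pure a b * pure c d = pure (a * c) (b * d).
Proof. exact: tmul_pure. Qed.

Lemma tmap1 (A B : algType K) (f : {lrmorphism A -> B}) : tmap f f 1 = 1.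
Proof.
by rewrite -[1]/(pure 1 1) tmap_pure ?rmorph1 //; exact: linearP.
Qed.

Lemma tmapM (A B : algType K) (f : {lrmorphism A -> B}) t u :
  tmap f f (t * u) = tmap f f t * tmap f f u.
Proof.
have lf := tmap_linear (linearP f) (linearP f).
move: t; apply: eq_tensor => [c t v|c t v|a b].
- by rewrite -[_ * u]/(tmul _ u) tmulPl lf.
- by rewrite lf -[_ * tmap f f u]/(tmul _ _) tmulPl.
move: u; apply: eq_tensor => [c t v|c t v|c d].
- by rewrite -[_ * _]/(tmul _ _) tmulPr lf.
- by rewrite lf -[_ * (_ + _)]/(tmul _ _) tmulPr.
by rewrite pureM !tmap_pure ?pureM ?rmorphM //; exact: linearP.
Qed.

(* Both [antipode \o phi] and [phi \o antipode] are convolution inverses of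
   [phi], so that coassociativity makes them equal. *)
Lemma hopf_morphism_bialgebra (A B : algType K) (HA : hopf_alg A)
    (HB : hopf_alg B) (phi : {lrmorphism A -> B}) :
  (forall x, comul HB (phi x) = tmap phi phi (comul HA x)) ->
  (forall x, counit HB (phi x) = counit HA x) -> hopf_morphism HA HB phi.
Proof.
move=> phi_comul phi_counit; split=> // x.
have lphi : linear phi := linearP phi.
have lcomul : linear (comul HA) := linearP (comul HA).
pose SL y := antipode HB (phi y); pose SR y := phi (antipode HA y).
have lSL : linear SL by move=> c y z; rewrite /SL !linearP.
have lSR : linear SR by move=> c y z; rewrite /SR !linearP.
have bmul (f g : A -> B) : linear f -> linear g -> bilin (fun a b => f a * g b).
  move=> lf lg; split=> y c u v; first by rewrite lf mulrDl scalerAl.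
  by rewrite lg mulrDr scalerAr.
have rmul (b : B) : linear ( *%R^~ b) by move=> c u v; rewrite mulrDl scalerAl.
(* [SL] is a left convolution inverse of [phi]: this is the antipode axiom of [B] at [phi y]. *)
have invL y : tlift (fun a b => SL a * phi b) (comul HA y) = (counit HA y)%:A.
  rewrite -phi_counit -(antipodel HB) phi_comul tlift_tmap //.
  split=> b c u v /=; first by rewrite linearP mulrDl scalerAl.
  by rewrite mulrDr scalerAr.
have bSL := bmul _ _ lSL lphi.
have bSR := bmul _ _ lphi lSR.
(* [SR] is a right convolution inverse of [phi]: this is [phi] applied to the antipode axiom of
   [A]. *)
have invR y : tlift (fun a b => phi a * SR b) (comul HA y) = (counit HA y)%:A.
  rewrite -[RHS](rmorph_alg phi) -(antipoder HA) tlift_comp //.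
    by apply: eq_tlift => a b; rewrite rmorphM.
  split=> b c u v /=; first by rewrite mulrDl scalerAl.
  by rewrite linearP mulrDr scalerAr.
(* [h] evaluates the triple convolution of [SL], [phi] and [SR] with the last two factors
   grouped. *)
pose h a t := SL a * tlift (fun b c => phi b * SR c) t.
have bh : bilin h.
  split=> [t|a] c u v; rewrite /h; first by rewrite lSL mulrDl scalerAl.
  by rewrite (tlift_linear bSR) mulrDr scalerAr.
have SRZ k y : SR (k *: y) = k *: SR y by rewrite /SR !linearZ.
have bL : bilin (fun a b : A => counit HA a *: b).
  split=> a c u v /=; last by rewrite scalerDr !scalerA mulrC.
  by rewrite linearP scalerDl scalerA.
have bR : bilin (fun a b : A => counit HA b *: a).
  split=> a c u v /=; first by rewrite scalerDr !scalerA mulrC.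
  by rewrite linearP scalerDl scalerA.
(* With this grouping [phi] and [SR] cancel, and the right counit axiom leaves [SL x]. *)
transitivity (tlift h (tmap idfun (comul HA) (comul HA x))).
  rewrite tlift_tmap // -[LHS]/(SL x) -{1}(counitr HA x) (tlift_comp _ lSL bR).
  by apply: eq_tlift => a b; rewrite /h invR mulr_algr /SL !linearZ.
(* After regrouping, [SL] and [phi] cancel instead, and the left counit axiom leaves [SR x]. *)
rewrite -comulA tlift_tassoc // tlift_tmap //.
- rewrite -[RHS]/(SR x) -[in RHS](counitl HA x) (tlift_comp _ lSR bL).
  apply: eq_tlift => a c; rewrite SRZ -mulr_algl -invL.
  rewrite (tlift_comp _ (rmul (SR c))) //.
  by apply: eq_tlift => a' b; rewrite /h tlift_pure ?mulrA.
- exact: (bilin_tlift_inner bh).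
Qed.
End TensorMaps.

(** * Commutation up to a scalar *)

Section IndexedProducts.
Variables (R : pzRingType) (n : nat) (x : 'I_n -> R) (i : 'I_n.-1).

Lemma prod_lt_hi :
  \prod_(j < n | (j < hi i)%N) x j = (\prod_(j < n | (j < lo i)%N) x j) * x (lo i).
Proof.
(* The default [lo i] of [insubd] is never reached, since the ranges stay below [n]. *)
pose F m := x (insubd (lo i) m).
have FE m : (m <= n)%N -> \prod_(j < n | (j < m)%N) x j = \prod_(0 <= j < m) F j.
  move=> mn; rewrite (big_nat_widen _ _ n) // big_mkord.
  by apply: eq_bigr => j _; rewrite /F valKd.
rewrite (FE _ (ltnW (hi_proof i))) (FE _ (ltnW (lo_proof i))) big_nat_recr //=; congr (_ * _).
by congr x; apply/val_inj; rewrite val_insubd /= lo_proof.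
Qed.

Lemma prod_gt_lo :
  \prod_(j < n | (lo i < j)%N) x j = x (hi i) * (\prod_(j < n | (hi i < j)%N) x j).
Proof.
pose F m := x (insubd (lo i) m).
have FE (m : 'I_n) : \prod_(j < n | (m < j)%N) x j = \prod_(m.+1 <= j < n) F j.
  by rewrite big_geq_mkord; apply: eq_bigr => j _; rewrite /F valKd.
rewrite !FE big_ltn ?hi_proof //; congr (_ * _).
by congr x; apply/val_inj; rewrite val_insubd /= hi_proof.
Qed.

End IndexedProducts.

Lemma inner_eps_alpha n (i : 'I_n) (j : 'I_n.-1) :
  inner (eps i) (alpha j) = kron i j - kron i j.+1.
Proof.
have dot l : inner (eps i) (eps l) = kron i l.
  rewrite /inner /eps trmx_delta mul_delta_mx_cond mulmxnE !mxE eqxx /kron.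
  by rewrite -[(i == l :> nat)]/(i == l); case: (i == l).
rewrite -[kron i j]/(kron i (lo j)) -[kron i j.+1]/(kron i (hi j)) -!dot.
by rewrite /inner /alpha linearB /= mulmxBr mxE; congr (_ + _); rewrite mxE.
Qed.

(** * Telescoping products of weights *)

Section Weights.
Variables (K : fieldType) (n : nat) (c : K) (i : 'I_n) (j : 'I_n.-1).
Hypothesis c0 : c != 0.

Lemma prod_expz_kron (P : pred 'I_n) (k : 'I_n) :
  \prod_(l < n | P l) c ^ kron l k = c ^ (P k : nat).
Proof.
case Pk: (P k).
  rewrite (bigD1 k) //= big1 => [|l /andP[_ /negPf lk]]; rewrite /kron ?eqxx ?mulr1 //.
  by rewrite [(_ == _)%N]lk.
rewrite big1 // => l Pl; rewrite /kron; case: eqP => // /val_inj lk.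
by rewrite -lk Pl in Pk.
Qed.

(** By bilinearity only the two indices in the support of [alpha j] contribute, so the exponent
    records their membership in [P]. *)
Lemma prod_weight (P : pred 'I_n) :
  \prod_(l < n | P l) c ^ inner (eps l) (alpha j) =
  c ^ ((P (lo j) : nat)%:Z - (P (hi j) : nat)%:Z).
Proof.
under eq_bigr => l _ do rewrite inner_eps_alpha expfzDr // -invr_expz.
by rewrite big_split prodfV /= !expfzDr // -invr_expz -!prod_expz_kron.
Qed.

(** The conditions [j < i] and [j + 1 < i] differ only for [i = j + 1]. *)
Lemma prod_weight_lt :
  \prod_(l < n | (l < i)%N) c ^ inner (eps l) (alpha j) = c ^ kron j.+1 i.
Proof.
rewrite prod_weight; congr (c ^ _); rewrite /kron /=.
by rewrite [(j < i)%N]leq_eqVlt; case: ltngtP.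
Qed.

(** The conditions [i < j] and [i < j + 1] differ only for [i = j], where the second alone holds;
    hence the sign. *)
Lemma prod_weight_gt :
  \prod_(l < n | (i < l)%N) c ^ inner (eps l) (alpha j) = c ^ (- kron j i).
Proof.
rewrite prod_weight; congr (c ^ _); rewrite /kron /= ltnS.
by case: ltngtP.
Qed.

End Weights.

(** * Skew commutation and twisted adjoint actions *)

Section SkewCommutation.
Variables (K : fieldType) (A : algType K).
Implicit Types (x y z v w : A) (c d : K).

Definition qcomm c x y := x * y = c *: (y * x).

Lemma qcomm1 y : qcomm 1 1 y.
Proof. by rewrite /qcomm scale1r mulr1 mul1r. Qed.

Lemma qcomm_comm x y : GRing.comm x y -> qcomm 1 x y.
Proof. by rewrite /qcomm scale1r. Qed.

Lemma qcommMl c d x x' y : qcomm c x y -> qcomm d x' y -> qcomm (c * d) (x * x') y.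
Proof.
rewrite /qcomm => xy x'y; rewrite -mulrA x'y -scalerAr [x * (y * x')]mulrA xy.
by rewrite -scalerAl scalerA -mulrA mulrC.
Qed.

Lemma qcommMr c d x y y' : qcomm c x y -> qcomm d x y' -> qcomm (c * d) x (y * y').
Proof.
rewrite /qcomm => xy xy'; rewrite mulrA xy -scalerAl -[y * x * y']mulrA xy'.
by rewrite -scalerAr scalerA mulrA.
Qed.

Lemma qcommZr c d x y : qcomm c x y -> qcomm c x (d *: y).
Proof. by rewrite /qcomm -scalerAr -scalerAl => ->; rewrite !scalerA mulrC. Qed.

Lemma qcommBr c x y z : qcomm c x y -> qcomm c x z -> qcomm c x (y - z).
Proof. by rewrite /qcomm mulrBr mulrBl scalerBr => -> ->. Qed.

Lemma qcomm_sym c x y : c != 0 -> qcomm c x y -> qcomm c^-1 y x.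
Proof. by move=> c0; rewrite /qcomm => ->; rewrite scalerA mulVf // scale1r. Qed.

Lemma qcommV c x x' y :
  c != 0 -> x * x' = 1 -> x' * x = 1 -> qcomm c x y -> qcomm c^-1 x' y.
Proof.
rewrite /qcomm => c0 xx' x'x xy; suff -> : y * x' = c *: (x' * y).
  by rewrite scalerA mulVf // scale1r.
rewrite -[LHS]mul1r -x'x -mulrA [x * (y * x')]mulrA xy -scalerAl -scalerAr.
by rewrite -mulrA xx' mulr1.
Qed.

Lemma qcomm_prod (I : finType) (P : pred I) (c : I -> K) (F : I -> A) y :
  (forall j, P j -> qcomm (c j) (F j) y) ->
  qcomm (\prod_(j | P j) c j) (\prod_(j | P j) F j) y.
Proof.
move=> FP; apply: (big_ind2 (fun c x => qcomm c x y)) => //; first exact: qcomm1.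
by move=> c1 x1 c2 x2; apply: qcommMl.
Qed.

Lemma comm_mulrACA x y z w : GRing.comm y z -> x * y * z * w = x * z * (y * w).
Proof. by move=> yz; rewrite -(mulrA x) yz !mulrA. Qed.

Lemma scaled_ad c d e w v v' x :
  (c *: e) * (d *: x) - w * (d *: x) * v * v' * (c *: e) =
  (c * d) *: (e * x - w * x * (v * v') * e).
Proof.
rewrite -!(scalerAl, scalerAr) !scalerA -scalerBr.
by rewrite !mulrA.
Qed.

(* [w * w'] stands for the inverse of [v]: the inner torus conjugation cancels against
   the factor [v] of [v * f]. *)
Lemma twisted_ad f v w w' x : w * w' * v = 1 ->
  (v * f) * x - v * x * w * w' * (v * f) = v * (f * x - x * f).
Proof.
move=> wv; rewrite mulrBr !mulrA; congr (_ - _ * _).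
by rewrite -!mulrA [w * _]mulrA wv mulr1.
Qed.

Section Serre.
Variables (e w w' : A).
Hypothesis ww' : w * w' = 1.

Lemma qcomm_conj d x : qcomm d w x -> w * x * w' = d *: x.
Proof. by rewrite /qcomm => ->; rewrite -scalerAl -mulrA ww' mulr1. Qed.

Lemma qcomm_ad d x : qcomm d w x -> e * x - w * x * w' * e = e * x - d *: (x * e).
Proof. by move=> wx; rewrite (qcomm_conj wx) -scalerAl. Qed.

(** The element [e * x - d *: (x * e)] again has a weight under [w], namely [c * d], so the second
    application is a twisted commutator with that scalar. *)
Lemma qcomm_ad2 c d x (ad := fun z => e * z - w * z * w' * e) :
    qcomm c w e -> qcomm d w x ->
  ad (ad x) = e ^+ 2 * x - (d * (1 + c)) *: (e * x * e) + (c * d ^+ 2) *: (x * e ^+ 2).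
Proof.
move=> we wx; rewrite /ad (qcomm_ad wx).
have wex : qcomm (c * d) w (e * x - d *: (x * e)).
  apply: qcommBr; first exact: qcommMr.
  by apply: qcommZr; rewrite mulrC; apply: qcommMr.
rewrite (qcomm_ad wex) mulrBr mulrBl -!(scalerAr, scalerAl) scalerBr scalerA.
rewrite !expr2 !mulrA mulrDr mulr1 scalerDl [d * c]mulrC.
by rewrite !opprD opprK !addrA.
Qed.

End Serre.

(** Moving [f] past [v'] costs [q], and past [v * v'] costs [p * q]. All torus factors can thus be
    collected on the left, leaving a polynomial in [f] and [g]. *)
Lemma commutator_serre p q v v' f g (ad := fun z => v * (f * z - z * f)) :
    qcomm p f v -> qcomm q f v' -> GRing.comm v v' ->
  ad (ad (v' * g)) = v * v * v' *
    ((p * q ^+ 2) *: (f ^+ 2 * g) - (q * (1 + p)) *: (f * g * f) + g * f ^+ 2).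
Proof.
move=> fv fv' vv'; rewrite /ad.
have adE u z t : qcomm t f u -> v * (f * (u * z) - u * z * f) =
    v * u * (t *: (f * z) - z * f).
  by rewrite /qcomm => fu; rewrite mulrA fu -scalerAl !mulrBr -!scalerAr !mulrA.
rewrite (adE _ _ _ fv') (adE _ _ _ (qcommMr fv fv')) mulrA; congr (_ * _).
rewrite mulrBr mulrBl -!(scalerAr, scalerAl) scalerBr scalerA expr2 !mulrA.
rewrite !expr2.
rewrite [1 + p]addrC mulrDr mulr1 [q * p]mulrC scalerDl.
by rewrite !opprD opprK !addrA.
Qed.
End SkewCommutation.

(** * Relations in the two-parameter quantum group *)

Section PresentedRelations.
Variables (K : fieldType) (X : choiceType) (R : freealg K X -> Prop).

Lemma ppi_rel x : R x -> ppi R x = 0.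
Proof.
move=> Rx; rewrite -(linear0 (ppi R)); apply/lpi_eq; rewrite subr0.
by apply: span_gen; exists 1, x, 1; rewrite mul1r mulr1.
Qed.

Lemma ppiD x y : ppi R (x + y) = ppi R x + ppi R y. Proof. exact: linearD. Qed.
Lemma ppiB x y : ppi R (x - y) = ppi R x - ppi R y. Proof. exact: linearB. Qed.
Lemma ppiZ c x : ppi R (c *: x) = c *: ppi R x. Proof. exact: linearZ. Qed.
Lemma ppiM x y : ppi R (x * y) = ppi R x * ppi R y. Proof. exact: rmorphM. Qed.
Definition ppiE := (ppiB, ppiD, ppiZ, ppiM).

Lemma pgen_qcomm g h c : R (fgen K g * fgen K h - c *: (fgen K h * fgen K g)) ->
  pgen R g * pgen R h = c *: (pgen R h * pgen R g).
Proof.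
move=> Rgh; apply/eqP; rewrite -subr_eq0 -!ppiM -ppiZ -ppiB.
by rewrite ppi_rel.
Qed.

Lemma pgen_comm g h : R (fgen K g * fgen K h - fgen K h * fgen K g) ->
  pgen R g * pgen R h = pgen R h * pgen R g.
Proof. by rewrite -[X in _ - X]scale1r => /pgen_qcomm; rewrite scale1r. Qed.

Lemma pgen_inv g h : R (fgen K g * fgen K h - 1) -> pgen R g * pgen R h = 1.
Proof.
move=> Rgh; apply/eqP; rewrite -subr_eq0 -(rmorph1 (ppi R)) -ppiM -ppiB.
by rewrite ppi_rel.
Qed.

End PresentedRelations.

(** * Torus products split at an index *)

Section TorusProducts.
Variables (K : fieldType) (A : algType K) (n : nat).
Implicit Types (x y : 'I_n -> A) (i : 'I_n).

(** The common shape of the images of [K_i], [L_i] and their inverses: [x] below [i], [y] above,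
    nothing at [i] itself. *)
Definition torus x y i :=
  (\prod_(j < n | (j < i)%N) x j) * (\prod_(j < n | (i < j)%N) y j).

Lemma comm_torus z x y i : (forall j, GRing.comm z (x j)) ->
  (forall j, GRing.comm z (y j)) -> GRing.comm z (torus x y i).
Proof.
by move=> zx zy; apply: commrM; apply: commr_prod => j _; [exact: zx | exact: zy].
Qed.

Lemma prod_inv x x' (P : pred 'I_n) :
    (forall j, x j * x' j = 1) -> (forall j k, GRing.comm (x j) (x' k)) ->
  (\prod_(j < n | P j) x j) * (\prod_(j < n | P j) x' j) = 1.
Proof.
move=> xx' cxx'; rewrite -prodrM_comm => [|j k _ _]; last exact: cxx'.
by rewrite big1.
Qed.

Lemma torus_inv x x' y y' i :
    (forall j, x j * x' j = 1) -> (forall j, y j * y' j = 1) ->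
    (forall j k, GRing.comm (x j) (x' k)) ->
    (forall j k, GRing.comm (y j) (y' k)) ->
    (forall j k, GRing.comm (y j) (x' k)) ->
  torus x y i * torus x' y' i = 1.
Proof.
move=> xx' yy' cxx' cyy' cyx'; rewrite /torus.
set Px := \prod_(j | _) x j; set Sy := \prod_(j | _) y j.
set Px' := \prod_(j | _) x' j; set Sy' := \prod_(j | _) y' j.
have cSP : Sy * Px' = Px' * Sy.
  by apply: commr_prod => j _; apply/commr_sym/commr_prod => k _; exact/commr_sym.
by rewrite mulrA -[Px * Sy * _]mulrA cSP mulrA -mulrA !prod_inv // mulr1.
Qed.

(** Passing from [lo i] to [hi i] adds the factor [x (lo i)] and drops [y (hi i)]; the latter is
    undone by its inverse [y' (hi i)]. *)
Lemma torus_hi x y y' (i : 'I_n.-1) :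
    (forall j, y j * y' j = 1) -> (forall j k, GRing.comm (y j) (y' k)) ->
    (forall j k, GRing.comm (x j) (y k)) ->
  torus x y (hi i) = torus x y (lo i) * (x (lo i) * y' (hi i)).
Proof.
move=> yy' cyy' cxy; rewrite /torus prod_lt_hi prod_gt_lo -!mulrA; congr (_ * _).
set S := \prod_(j | _) y j.
have cS : S * (x (lo i) * y' (hi i)) = x (lo i) * y' (hi i) * S.
  by apply: commrM; apply/commr_sym/commr_prod => j _; [exact: cxy | exact/commr_sym].
by rewrite cS !mulrA -cxy -[x _ * y _ * y' _]mulrA yy' mulr1.
Qed.

Lemma torus_qcomm (c d : K) x y i (j : 'I_n.-1) (z : A) : c != 0 -> d != 0 ->
    (forall l, qcomm (c ^ inner (eps l) (alpha j)) (x l) z) ->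
    (forall l, qcomm (d ^ inner (eps l) (alpha j)) (y l) z) ->
  qcomm (c ^ kron j.+1 i * d ^ (- kron j i)) (torus x y i) z.
Proof.
move=> c0 d0 xz yz; rewrite -prod_weight_lt // -prod_weight_gt //.
by apply: qcommMl; apply: qcomm_prod.
Qed.

End TorusProducts.

(** * Commutation and Serre relations in the quotient *)

Section UrsRelations.
Variables (K : fieldType) (n : nat) (r s : K).
Hypotheses (r0 : r != 0) (s0 : s != 0).
Local Notation U := (Urs n r s).
Local Notation gen := (@pgen K (Ugens n) (@Urel K n r s)).
Local Notation ue := (@ue K n r s).
Local Notation uf := (@uf K n r s).
Local Notation ua := (@ua K n r s).
Local Notation uaV := (@uaV K n r s).
Local Notation ub := (@ub K n r s).
Local Notation ubV := (@ubV K n r s).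

Lemma toral_comm g h : Utoral g -> Utoral h -> GRing.comm (gen g : U) (gen h : U).
Proof. by move=> tg th; apply/pgen_comm/R1_comm. Qed.

Lemma ua_V i : ua i * uaV i = 1. Proof. exact/pgen_inv/R1_a. Qed.
Lemma ub_V i : ub i * ubV i = 1. Proof. exact/pgen_inv/R1_b. Qed.
Lemma uaV_a i : uaV i * ua i = 1.
Proof. by rewrite -[RHS](ua_V i); exact: toral_comm. Qed.
Lemma ubV_b i : ubV i * ub i = 1.
Proof. by rewrite -[RHS](ub_V i); exact: toral_comm. Qed.

Lemma ua_e i j : qcomm (r ^ inner (eps i) (alpha j)) (ua i) (ue j).
Proof. exact/pgen_qcomm/R2_e. Qed.
Lemma ub_e i j : qcomm (s ^ inner (eps i) (alpha j)) (ub i) (ue j).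
Proof. exact/pgen_qcomm/R3_e. Qed.
(** The sign of the exponent is moved into the base, so that the weight has the form [c ^ inner]
    expected by [torus_qcomm]. *)
Lemma ua_f i j : qcomm (r^-1 ^ inner (eps i) (alpha j)) (ua i) (uf j).
Proof. rewrite exprz_inv; exact/pgen_qcomm/R2_f. Qed.
Lemma ub_f i j : qcomm (s^-1 ^ inner (eps i) (alpha j)) (ub i) (uf j).
Proof. rewrite exprz_inv; exact/pgen_qcomm/R3_f. Qed.

Lemma uaV_e i j : qcomm (r^-1 ^ inner (eps i) (alpha j)) (uaV i) (ue j).
Proof.
rewrite exprz_inv -invr_expz.
by apply: (qcommV _ (ua_V i) (uaV_a i) (ua_e i j)); rewrite expfz_neq0.
Qed.
Lemma ubV_e i j : qcomm (s^-1 ^ inner (eps i) (alpha j)) (ubV i) (ue j).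
Proof.
rewrite exprz_inv -invr_expz.
by apply: (qcommV _ (ub_V i) (ubV_b i) (ub_e i j)); rewrite expfz_neq0.
Qed.
Lemma uaV_f i j : qcomm (r ^ inner (eps i) (alpha j)) (uaV i) (uf j).
Proof.
rewrite -[r in r ^ _]invrK exprz_inv -invr_expz.
by apply: (qcommV _ (ua_V i) (uaV_a i) (ua_f i j)); rewrite expfz_neq0 ?invr_eq0.
Qed.
Lemma ubV_f i j : qcomm (s ^ inner (eps i) (alpha j)) (ubV i) (uf j).
Proof.
rewrite -[s in s ^ _]invrK exprz_inv -invr_expz.
by apply: (qcommV _ (ub_V i) (ubV_b i) (ub_f i j)); rewrite expfz_neq0 ?invr_eq0.
Qed.

Lemma ue_uf i j : ue i * uf j - uf j * ue i =
  ((i == j)%:R / (r - s)) *: (omega r s i - omega' r s i).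
Proof.
apply/eqP; rewrite -subr_eq0; apply/eqP.
have /ppi_rel := R4 r s i j.
by rewrite !ppiE.
Qed.

Lemma ue_comm (i j : 'I_n.-1) : (1 < `|i%:Z - j%:Z|)%N -> ue i * ue j = ue j * ue i.
Proof. by move=> ij; apply/pgen_comm/R5_e. Qed.
Lemma uf_comm (i j : 'I_n.-1) : (1 < `|i%:Z - j%:Z|)%N -> uf i * uf j = uf j * uf i.
Proof. by move=> ij; apply/pgen_comm/R5_f. Qed.

Lemma ue_serre_l (i j : 'I_n.-1) : j = i.+1 :> nat ->
  ue i ^+ 2 * ue j - (r + s) *: (ue i * ue j * ue i) + (r * s) *: (ue j * ue i ^+ 2) = 0.
Proof.
move=> ij; have /ppi_rel := R6_l r s ij.
by rewrite !(expr2, ppiE).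
Qed.
Lemma ue_serre_r (i j : 'I_n.-1) : j = i.+1 :> nat ->
  ue i * ue j ^+ 2 - (r + s) *: (ue j * ue i * ue j) + (r * s) *: (ue j ^+ 2 * ue i) = 0.
Proof.
by move=> ij; have /ppi_rel := R6_r r s ij; rewrite !(expr2, ppiE).
Qed.
Lemma uf_serre_l (i j : 'I_n.-1) : j = i.+1 :> nat ->
  uf i ^+ 2 * uf j - (r^-1 + s^-1) *: (uf i * uf j * uf i)
    + (r^-1 * s^-1) *: (uf j * uf i ^+ 2) = 0.
Proof.
by move=> ij; have /ppi_rel := R7_l r s ij; rewrite !(expr2, ppiE).
Qed.
Lemma uf_serre_r (i j : 'I_n.-1) : j = i.+1 :> nat ->
  uf i * uf j ^+ 2 - (r^-1 + s^-1) *: (uf j * uf i * uf j)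
    + (r^-1 * s^-1) *: (uf j ^+ 2 * uf i) = 0.
Proof.
by move=> ij; have /ppi_rel := R7_r r s ij; rewrite !(expr2, ppiE).
Qed.

End UrsRelations.

(** * Images of the generators *)

Section Indices.
Variable n : nat.
Implicit Types i j : 'I_n.-1.

(** The first two cases give Serre exponent 2 and call on different cubic relations; the last gives
    exponent 1 and plain commutation. *)
Variant index_rel i j : Prop :=
| IndexSucc of j = i.+1 :> nat
| IndexPred of i = j.+1 :> nat
| IndexFar of (1 < `|i%:Z - j%:Z|)%N.

Lemma index_relP i j : i != j -> index_rel i j.
Proof.
move=> ij; have {ij} : (i : nat) != j by [].
case: (ltngtP i j) => // ij _.
  by have [e|ne] := eqVneq (j : nat) i.+1; [apply: IndexSucc | apply: IndexFar; lia].
by have [e|ne] := eqVneq (i : nat) j.+1; [apply: IndexPred | apply: IndexFar; lia].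
Qed.

Lemma inner_lo_diag i : inner (eps (lo i)) (alpha i) = 1.
Proof. by rewrite inner_eps_alpha /kron eqxx ltn_eqF. Qed.

Lemma inner_hi_diag i : inner (eps (hi i)) (alpha i) = -1.
Proof. by rewrite inner_eps_alpha /kron eqxx gtn_eqF. Qed.

Lemma inner_lo_succ i j : j = i.+1 :> nat -> inner (eps (lo i)) (alpha j) = 0.
Proof. by move=> ij; rewrite inner_eps_alpha /kron /= ij !ltn_eqF. Qed.

Lemma inner_hi_succ i j : j = i.+1 :> nat -> inner (eps (hi i)) (alpha j) = 1.
Proof. by move=> ij; rewrite inner_eps_alpha /kron /= ij eqxx ltn_eqF. Qed.

Lemma inner_lo_pred i j : i = j.+1 :> nat -> inner (eps (lo i)) (alpha j) = -1.
Proof. by move=> ij; rewrite inner_eps_alpha /kron /= ij eqxx gtn_eqF. Qed.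

Lemma inner_hi_pred i j : i = j.+1 :> nat -> inner (eps (hi i)) (alpha j) = 0.
Proof. by move=> ij; rewrite inner_eps_alpha /kron /= ij !gtn_eqF. Qed.

Lemma inner_lo_far i j : (1 < `|i%:Z - j%:Z|)%N -> inner (eps (lo i)) (alpha j) = 0.
Proof. by move=> ij; rewrite inner_eps_alpha /kron /=; do 2!case: eqP => //=; lia. Qed.

Lemma inner_hi_far i j : (1 < `|i%:Z - j%:Z|)%N -> inner (eps (hi i)) (alpha j) = 0.
Proof. by move=> ij; rewrite inner_eps_alpha /kron /=; do 2!case: eqP => //=; lia. Qed.

(** Splitting [alpha i] lets the tabulated pairings above compute the exponent. *)
Lemma serre_exponentE i j :
  serre_exponent i j = `|1 - (inner (eps (lo i)) (alpha j) - inner (eps (hi i)) (alpha j))%R|%N.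
Proof.
rewrite /serre_exponent; congr `|1 - _|%N; rewrite {1}/inner {1}/alpha mulmxBl mxE.
by congr (_ + _); rewrite mxE.
Qed.

End Indices.

Section Phi.
Variables (K : fieldType) (n : nat) (r s : K).
Hypotheses (r0 : r != 0) (s0 : s != 0) (rs : r != s).
Local Notation U := (Urs n r s).
Local Notation gen := (@pgen K (Ugens n) (@Urel K n r s)).
Local Notation ue := (@ue K n r s).
Local Notation uf := (@uf K n r s).
Local Notation ua := (@ua K n r s).
Local Notation uaV := (@uaV K n r s).
Local Notation ub := (@ub K n r s).
Local Notation ubV := (@ubV K n r s).
Local Notation omega := (@omega K n r s).
Local Notation omega' := (@omega' K n r s).
Local Notation omega'V := (@omega'V K n r s).

(* Membership in the double centralizer of the torus generators: closed under products,
   and commutative since these generators commute. *)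
Definition toral (x : U) :=
  forall y : U, (forall g, Utoral g -> GRing.comm y (gen g)) -> GRing.comm y x.

Lemma toral_gen g : Utoral g -> toral (gen g).
Proof. by move=> tg y; apply. Qed.

Lemma toralM x y : toral x -> toral y -> toral (x * y).
Proof. by move=> tx ty z zg; apply: commrM; [exact: tx | exact: ty]. Qed.

Lemma toral_torus (x y : 'I_n -> U) i : (forall j, toral (x j)) -> (forall j, toral (y j)) ->
  toral (torus x y i).
Proof. by move=> tx ty z zg; apply: comm_torus => j; [exact: tx | exact: ty]. Qed.

(** As torus generators commute with each other, each lies in the centralizer tested by [toral x],
    so [x] commutes with all of them. Then [toral y] applies to [x]. *)
Lemma commute_toral x y : toral x -> toral y -> GRing.comm x y.
Proof.
move=> tx ty; apply: (ty) => g tg; apply/commr_sym; apply: (tx) => h th.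
exact: toral_comm.
Qed.

Definition phiL := torus ua ubV.
Definition phiLV := torus uaV ub.
Definition phiK := torus ubV ua.
Definition phiKV := torus ub uaV.
Definition phiE_coef : K := - s^-1 * (r - s) ^+ 2.
Definition phiE j : U := phiE_coef *: ue j.
Definition phiF j : U := omega'V j * uf j.

Lemma toral_phiL i : toral (phiL i).
Proof. by apply: toral_torus => j; exact: toral_gen. Qed.
Lemma toral_phiLV i : toral (phiLV i).
Proof. by apply: toral_torus => j; exact: toral_gen. Qed.
Lemma toral_phiK i : toral (phiK i).
Proof. by apply: toral_torus => j; exact: toral_gen. Qed.
Lemma toral_phiKV i : toral (phiKV i).
Proof. by apply: toral_torus => j; exact: toral_gen. Qed.
Lemma toral_omega j : toral (omega j).
Proof. by apply: toralM; exact: toral_gen. Qed.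
Lemma toral_omega'V j : toral (omega'V j).
Proof. by apply: toralM; exact: toral_gen. Qed.

Lemma phiL_V i : phiL i * phiLV i = 1.
Proof. by apply: torus_inv => *; rewrite ?ua_V ?ubV_b //; exact: toral_comm. Qed.
Lemma phiK_V i : phiK i * phiKV i = 1.
Proof. by apply: torus_inv => *; rewrite ?ua_V ?ubV_b //; exact: toral_comm. Qed.

Lemma phiL_hi i : phiL (hi i) = phiL (lo i) * omega i.
Proof. by apply: torus_hi => *; rewrite ?ubV_b //; exact: toral_comm. Qed.
Lemma phiK_hi i : phiK (hi i) = phiK (lo i) * omega'V i.
Proof.
(* [torus_hi] produces [ubV (lo i) * uaV (hi i)], the factors of [omega'V i] in reverse order. *)
rewrite [LHS](@torus_hi _ _ _ _ _ uaV) => *; rewrite ?ua_V //; first last.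
- exact: toral_comm.
- exact: toral_comm.
by congr (_ * _); exact: toral_comm.
Qed.

Lemma phiL_ratio i : phiL (hi i) * phiLV (lo i) = omega i.
Proof.
rewrite phiL_hi (commute_toral (toral_phiL _) (toral_omega _)).
by rewrite -mulrA phiL_V mulr1.
Qed.
Lemma phiK_ratio i : phiK (hi i) * phiKV (lo i) = omega'V i.
Proof.
rewrite phiK_hi (commute_toral (toral_phiK _) (toral_omega'V _)).
by rewrite -mulrA phiK_V mulr1.
Qed.

Lemma omega_V i : omega i * (phiL (lo i) * phiLV (hi i)) = 1.
Proof.
rewrite mulrA -(commute_toral (toral_phiL _) (toral_omega _)) -phiL_hi.
exact: phiL_V.
Qed.
Lemma V_omega'V i : phiK (lo i) * phiKV (hi i) * omega'V i = 1.
Proof.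
rewrite (commute_toral (toralM (toral_phiK _) (toral_phiKV _)) (toral_omega'V _)).
rewrite mulrA -(commute_toral (toral_phiK _) (toral_omega'V _)) -phiK_hi.
exact: phiK_V.
Qed.
Lemma omega'V_omega' i : omega'V i * omega' i = 1.
Proof.
rewrite /Defs.omega'V /Defs.omega' mulrA -[_ * _ * ua _]mulrA.
have -> : ubV (lo i) * ua (hi i) = ua (hi i) * ubV (lo i) by exact: toral_comm.
by rewrite !mulrA uaV_a // mul1r ubV_b.
Qed.

Lemma phiK_e (i : 'I_n.-1) (j : 'I_n) :
  qcomm (r ^ (- kron i j) * s ^ (- kron i.+1 j)) (phiK j) (ue i).
Proof.
rewrite mulrC -exprz_inv; apply: torus_qcomm => //.
- by rewrite invr_eq0.
- by move=> l; exact: ubV_e.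
- by move=> l; exact: ua_e.
Qed.
Lemma phiL_e (i : 'I_n.-1) (j : 'I_n) :
  qcomm (r ^ kron i.+1 j * s ^ kron i j) (phiL j) (ue i).
Proof.
rewrite -[kron i j]opprK -[s ^ _]exprz_inv; apply: torus_qcomm => //.
- by rewrite invr_eq0.
- by move=> l; exact: ua_e.
- by move=> l; exact: ubV_e.
Qed.
Lemma phiK_f (i : 'I_n.-1) (j : 'I_n) :
  qcomm (r ^ kron i j * s ^ kron i.+1 j) (phiK j) (uf i).
Proof.
rewrite mulrC -[kron i j]opprK -[r ^ _]exprz_inv; apply: torus_qcomm => //.
- by rewrite invr_eq0.
- by move=> l; exact: ubV_f.
- by move=> l; exact: ua_f.
Qed.
Lemma phiL_f (i : 'I_n.-1) (j : 'I_n) :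
  qcomm (r ^ (- kron i.+1 j) * s ^ (- kron i j)) (phiL j) (uf i).
Proof.
rewrite -exprz_inv; apply: torus_qcomm => //.
- by rewrite invr_eq0.
- by move=> l; exact: ua_f.
- by move=> l; exact: ubV_f.
Qed.

(** The torus factor of [phiF j] commutes with [x], so only [uf j] contributes a weight. *)
Lemma toral_phiF c x (j : 'I_n.-1) : toral x -> qcomm c x (uf j) -> qcomm c x (phiF j).
Proof.
move=> tx xf; rewrite -[c]mul1r; apply: qcommMr xf; apply: qcomm_comm.
exact: (commute_toral tx (toral_omega'V _)).
Qed.

(** Inverting the torus element and exchanging the two sides each invert the weight, so the weight
    is that of [omega' j] itself. *)
Lemma e_omega'V i j :
  qcomm (r ^ inner (eps (hi j)) (alpha i) * s ^ inner (eps (lo j)) (alpha i))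
    (ue i) (omega'V j).
Proof.
rewrite -[X in qcomm X]invrK invfM; apply: qcomm_sym.
  by rewrite mulf_neq0 ?invr_eq0 ?expfz_neq0.
by rewrite !invr_expz -!exprz_inv; apply: qcommMl; [exact: uaV_e | exact: ubV_e].
Qed.
Lemma f_omega'V i j :
  qcomm (r ^ (- inner (eps (hi j)) (alpha i)) * s ^ (- inner (eps (lo j)) (alpha i)))
    (uf i) (omega'V j).
Proof.
rewrite -!invr_expz -invfM; apply: qcomm_sym.
  by rewrite mulf_neq0 ?expfz_neq0.
by apply: qcommMl; [exact: uaV_f | exact: ubV_f].
Qed.
Lemma omega_e i j :
  qcomm (r ^ inner (eps (lo i)) (alpha j) * s ^ inner (eps (hi i)) (alpha j))
    (omega i) (ue j).
Proof. by apply: qcommMl; [exact: ua_e | exact: ub_e]. Qed.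

(** The scalar [w] is what [ue i] picks up in passing [omega'V j], so the skew commutator becomes
    [omega'V j] times the ordinary commutator of [ue i] and [uf j]. *)
Lemma phiE_phiF i j (w := r ^ inner (eps (hi j)) (alpha i) * s ^ inner (eps (lo j)) (alpha i)) :
  phiE i * phiF j - w *: (phiF j * phiE i) =
  (phiE_coef * w * ((i == j)%:R / (r - s))) *: (omega'V j * (omega i - omega' i)).
Proof.
rewrite /phiE /phiF -!(scalerAl, scalerAr) scalerA mulrA e_omega'V -/w.
rewrite -scalerAl scalerA [w * _]mulrC -scalerBr.
rewrite -!(mulrA (omega'V j)) -(mulrBr (omega'V j)) ue_uf.
by rewrite -scalerAr scalerA.
Qed.

Definition phi_gen (g : Hgen n) : U :=
  match g with
  | HE j => phiE j | HF j => phiF j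
  | HK i => phiK i | HKV i => phiKV i | HL i => phiL i | HLV i => phiLV i
  end.
Local Notation ext := (@extend K (Hgens n) U phi_gen).

Lemma toral_phi_gen g : Htoral g -> toral (phi_gen g).
Proof.
case: g => //= i _; [exact: toral_phiK | exact: toral_phiKV
                    | exact: toral_phiL | exact: toral_phiLV].
Qed.

Lemma phi_EF_diag i :
  phiE i * phiF i - (r^-1 * s) *: (phiF i * phiE i) -
  (r^-1 * s - 1) *: (phiL (hi i) * phiK (hi i) * phiLV (lo i) * phiKV (lo i) - 1) = 0.
Proof.
have -> : phiL (hi i) * phiK (hi i) * phiLV (lo i) * phiKV (lo i) =
    omega i * omega'V i.
  rewrite -phiL_ratio -phiK_ratio; apply: comm_mulrACA.
  exact: (commute_toral (toral_phiK _) (toral_phiLV _)).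
have := phiE_phiF i i; rewrite inner_hi_diag inner_lo_diag exprN1 expr1z => ->.
rewrite mulrBr omega'V_omega' eqxx mulr1n (commute_toral (toral_omega'V _) (toral_omega _)).
(* Here the choice of [phiE_coef] matters: [-s^-1 (r-s)^2 * (r^-1 s) / (r-s)] equals
   [r^-1 s - 1]. *)
rewrite -scalerBl (_ : _ - _ = 0) ?scale0r // /phiE_coef.
have rs0 : r - s != 0 by rewrite subr_eq0.
by field; rewrite r0 s0 rs0.
Qed.

Lemma phi_EF i j : i != j ->
  phiE i * phiF j - (r ^ kron i j.+1 * s ^ (- kron i.+1 j)) *: (phiF j * phiE i) = 0.
Proof.
move=> ij; have ij' : (j == i :> nat) = false by rewrite eq_sym; exact: negPf.
have -> : kron i j.+1 = inner (eps (hi j)) (alpha i).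
  by rewrite inner_eps_alpha /kron /= eqSS ij' subr0 eq_sym.
have -> : - kron i.+1 j = inner (eps (lo j)) (alpha i).
  by rewrite inner_eps_alpha /kron /= ij' sub0r eq_sym.
by rewrite phiE_phiF (negPf ij) mulr0n mul0r mulr0 scale0r.
Qed.

(** * Serre relations for the images *)

Definition adE_img i (x : U) :=
  phiE i * x - phiL (hi i) * phiLV (lo i) * x * phiL (lo i) * phiLV (hi i) * phiE i.
Definition adF_img i (x : U) :=
  phiF i * x - phiK (hi i) * phiKV (lo i) * x * phiK (lo i) * phiKV (hi i) * phiF i.

Lemma adE_imgZ c i x : adE_img i (c *: x) = (phiE_coef * c) *:
  (ue i * x - omega i * x * (phiL (lo i) * phiLV (hi i)) * ue i).
Proof.
by rewrite /adE_img phiL_ratio scaled_ad. Qed.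

(** The torus conjugation cancels against the factor [omega'V i] of [phiF i], leaving an untwisted
    commutator. *)
Lemma adF_imgE i x : adF_img i x = omega'V i * (uf i * x - x * uf i).
Proof.
by rewrite /adF_img phiK_ratio twisted_ad // V_omega'V. Qed.

Lemma phi_adE i j : i != j -> iter (serre_exponent i j) (adE_img i) (phiE j) = 0.
Proof.
move=> ij; rewrite serre_exponentE.
have V_omega : phiL (lo i) * phiLV (hi i) * omega i = 1.
  rewrite -[RHS](omega_V i).
  exact: (commute_toral (toralM (toral_phiL _) (toral_phiLV _)) (toral_omega _)).
have we := omega_e i i; rewrite inner_lo_diag inner_hi_diag expr1z exprN1 in we.
have wx := omega_e i j.
case: (index_relP ij) => [ij1|ij1|far] in wx *.
(* For [j = i + 1] the weights are [c = r / s] and [d = s], so the coefficients are [r + s] and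
   [r * s], as in [ue_serre_l]. *)
- rewrite inner_lo_succ // inner_hi_succ //= in wx *.
  rewrite expr0z expr1z mul1r in wx.
  have ad2 := qcomm_ad2 (omega_V i) we wx.
  rewrite /phiE !adE_imgZ ad2 -[RHS](scaler0 _ (phiE_coef * (phiE_coef * phiE_coef))).
  congr (_ *: _); rewrite -[RHS](ue_serre_l r s ij1).
  by congr (_ - _ *: _ + _ *: _); field; rewrite s0.
(* For [i = j + 1] one has [d = r^-1], and the result is [ue_serre_r], with the indices exchanged,
   divided by [r * s]. *)
- rewrite inner_lo_pred // inner_hi_pred //= in wx *.
  rewrite expr0z exprN1 mulr1 in wx.
  have ad2 := qcomm_ad2 (omega_V i) we wx.
  rewrite /phiE !adE_imgZ ad2 -[RHS](scaler0 _ (phiE_coef * (phiE_coef * phiE_coef))).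
  congr (_ *: _); rewrite -(scaler0 _ (r^-1 * s^-1)) -(ue_serre_r r s ij1).
  rewrite scalerDr scalerBr !scalerA [RHS]addrC [X in _ = _ + X]addrC [RHS]addrA.
  rewrite [r^-1 / s * (r * s)](_ : _ = 1) ?scale1r; last by field; rewrite r0 s0.
  by congr (_ - _ *: _ + _ *: _); field; rewrite ?r0 ?s0.
- rewrite inner_lo_far // inner_hi_far //= in wx *.
  rewrite !expr0z mulr1 in wx.
  by rewrite /phiE adE_imgZ (qcomm_ad _ (omega_V i) wx) scale1r ue_comm // subrr scaler0.
Qed.

Lemma phi_adF i j : i != j -> iter (serre_exponent i j) (adF_img i) (phiF j) = 0.
Proof.
move=> ij; rewrite serre_exponentE.
have fv := f_omega'V i i.
rewrite inner_lo_diag inner_hi_diag opprK expr1z exprN1 in fv.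
(* In this weight [alpha i] is paired with the vectors of index [j], so each case below evaluates it
   by the table for the opposite order. *)
have fv' := f_omega'V i j.
have vv' := commute_toral (toral_omega'V i) (toral_omega'V j).
rewrite /phiF; case: (index_relP ij) => [ij1|ij1|far].
(* Here [p = r / s] and [q = s], which gives [r * s] times [uf_serre_l]. *)
- rewrite (inner_lo_succ ij1) (inner_hi_succ ij1) /= !adF_imgE.
  rewrite (inner_lo_pred ij1) (inner_hi_pred ij1) opprK expr1z oppr0 expr0z mul1r in fv'.
  have ad2 := commutator_serre (uf j) fv fv' vv'.
  rewrite ad2 -[RHS](mulr0 (omega'V i * omega'V i * omega'V j)).
  congr (_ * _); rewrite -(scaler0 _ (r * s)) -(uf_serre_l r s ij1).
  rewrite scalerDr scalerBr !scalerA.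
  rewrite [r * s * (r^-1 / s)](_ : _ = 1) ?scale1r; last by field; rewrite r0 s0.
  by congr (_ *: _ - _ *: _ + _); field; rewrite ?r0 ?s0.
(* Here [q = r^-1], which gives [uf_serre_r] with its outer terms exchanged. *)
- rewrite (inner_lo_pred ij1) (inner_hi_pred ij1) /= !adF_imgE.
  rewrite (inner_lo_succ ij1) (inner_hi_succ ij1) oppr0 expr0z exprN1 mulr1 in fv'.
  have ad2 := commutator_serre (uf j) fv fv' vv'.
  rewrite ad2 -[RHS](mulr0 (omega'V i * omega'V i * omega'V j)).
  congr (_ * _); rewrite -(uf_serre_r r s ij1).
  rewrite [RHS]addrC [X in _ = _ + X]addrC [RHS]addrA.
  by congr (_ *: _ - _ *: _ + _); field; rewrite ?r0 ?s0.
- rewrite (inner_lo_far far) (inner_hi_far far) /= adF_imgE.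
  have far' : (1 < `|j%:Z - i%:Z|)%N by rewrite distnC.
  rewrite (inner_lo_far far') (inner_hi_far far') oppr0 !expr0z mulr1 in fv'.
  have {}fv' : uf i * omega'V j = omega'V j * uf i by rewrite fv' scale1r.
  rewrite mulrA fv' -!(mulrA (omega'V j)) (uf_comm r s far) subrr mulr0 //.
Qed.

Lemma ext_rel x : Hrel r s x -> ext x = 0.
Proof.
(* The adjoint actions live on the free algebra; intertwining one application with its image handles
   every iterate. *)
have ext_iter (ad : freealg K (Hgens n) -> freealg K (Hgens n)) (ad' : U -> U) m z :
    (forall y, ext (ad y) = ad' (ext y)) -> ext (iter m ad z) = iter m ad' (ext z).
  by move=> adE; elim: m => //= m <-.
case=> {x} [g h tg th|i|i|i j|i j|i j|i j|i|i j ij|i j ij|i j ij].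
- rewrite extendB !extendM !extend_gen.
  by rewrite (commute_toral (toral_phi_gen tg) (toral_phi_gen th)) subrr.
- by rewrite extendB extendM !extend_gen extend1 [_ * _]phiK_V subrr.
- by rewrite extendB extendM !extend_gen extend1 [_ * _]phiL_V subrr.
- rewrite extendB extendZ !extendM !extend_gen.
  by rewrite [phi_gen _ * _](qcommZr _ (phiK_e i j)) subrr.
- rewrite extendB extendZ !extendM !extend_gen.
  by rewrite [phi_gen _ * _](toral_phiF (toral_phiK j) (phiK_f i j)) subrr.
- rewrite extendB extendZ !extendM !extend_gen.
  by rewrite [phi_gen _ * _](qcommZr _ (phiL_e i j)) subrr.
- rewrite extendB extendZ !extendM !extend_gen.
  by rewrite [phi_gen _ * _](toral_phiF (toral_phiL j) (phiL_f i j)) subrr.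
- by rewrite !(extendB, extendZ, extendM, extend_gen, extend1); exact: phi_EF_diag.
- by rewrite !(extendB, extendZ, extendM, extend_gen); exact: phi_EF.
- rewrite (ext_iter _ (adE_img i)) ?extend_gen => [|y]; first exact: phi_adE.
  by rewrite /adE !(extendB, extendM, extend_gen).
- rewrite (ext_iter _ (adF_img i)) ?extend_gen => [|y]; first exact: phi_adF.
  by rewrite /adF !(extendB, extendM, extend_gen).
Qed.

End Phi.

(** * The Hopf algebra morphism *)

Section Grouplike.
Variables (K : fieldType) (A : algType K) (H : hopf_alg A).
Implicit Types x y : A.

Lemma grouplike1 : grouplike H 1.
Proof. by rewrite /grouplike !rmorph1. Qed.

Lemma grouplikeM x y : grouplike H x -> grouplike H y -> grouplike H (x * y).
Proof.
by move=> [x1 x2] [y1 y2]; rewrite /grouplike !rmorphM /= x1 x2 y1 y2 pureM mul1r.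
Qed.

Lemma grouplike_torus n (x y : 'I_n -> A) i : (forall j, grouplike H (x j)) ->
  (forall j, grouplike H (y j)) -> grouplike H (torus x y i).
Proof.
move=> gx gy; apply: grouplikeM; apply: (big_ind (grouplike H)) => //;
  by [exact: grouplike1 | exact: grouplikeM].
Qed.

(** The left counit axiom reads [counit H x *: 1 + x = x]. *)
Lemma skew_primitive_counit x g : grouplike H g ->
  comul H x = pure x 1 + pure g x -> counit H x = 0.
Proof.
move=> [_ g1] Hx; have := counitl H x; rewrite Hx.
have bL : bilin (fun a b : A => counit H a *: b).
  split=> a c u v /=; last by rewrite scalerDr !scalerA mulrC.
  by rewrite linearP scalerDl scalerA.
have := tlift_linear bL 1 (pure x 1) (pure g x).
rewrite !scale1r !tlift_pure // => ->; rewrite g1 scale1r.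
move/(canRL (addrK _)); rewrite subrr => /eqP.
by rewrite scaler_eq0 oner_eq0 orbF => /eqP.
Qed.

End Grouplike.

Lemma pureZl (K : fieldType) (A B : lmodType K) c (a : A) (b : B) :
  pure (c *: a) b = c *: pure a b.
Proof.
have := pureDl c a 0 b; rewrite addr0 => ->.
by rewrite (lin0 ((bilin_pure A B).1 b)) addr0.
Qed.

Lemma pureZr (K : fieldType) (A B : lmodType K) c (a : A) (b : B) :
  pure a (c *: b) = c *: pure a b.
Proof.
have := pureDr c a b 0; rewrite addr0 => ->.
by rewrite (lin0 ((bilin_pure A B).2 a)) addr0.
Qed.

(** * Coproducts of the images *)

Section HopfValues.
Variables (K : fieldType) (n : nat) (r s : K) (H : hopf_alg (Urs n r s)).
Hypothesis specH : is_Urs_hopf H.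

Lemma grouplike_phi_gen g : Htoral g -> grouplike H (phi_gen r s g).
Proof.
by case: g => //= i _; apply: grouplike_torus => j; case: (Urs_grouplike specH j).
Qed.

Lemma grouplike_omega j : grouplike H (omega r s j).
Proof.
have [ga _ _ _] := Urs_grouplike specH (lo j).
by have [_ _ gb _] := Urs_grouplike specH (hi j); exact: grouplikeM.
Qed.

Lemma grouplike_omega'V j : grouplike H (omega'V r s j).
Proof.
have [_ gaV _ _] := Urs_grouplike specH (hi j).
by have [_ _ _ gbV] := Urs_grouplike specH (lo j); exact: grouplikeM.
Qed.

Lemma comul_phiE j : comul H (phiE r s j) =
  pure (phiE r s j) 1 + pure (omega r s j) (phiE r s j).
Proof.
by rewrite /phiE linearZ /= (Urs_comul_e specH) scalerDr pureZl pureZr.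
Qed.

(** Multiplying the coproduct of [uf j] by [pure (omega'V j) (omega'V j)] cancels [omega' j] in the
    right leg and puts [omega'V j] in the left leg of the other term. *)
Lemma comul_phiF j : comul H (phiF r s j) =
  pure (phiF r s j) 1 + pure (omega'V r s j) (phiF r s j).
Proof.
have gV := grouplike_omega'V j.
rewrite /phiF rmorphM /= gV.1 (Urs_comul_f specH) mulrDr !pureM mulr1.
by rewrite omega'V_omega' addrC.
Qed.

End HopfValues.

Lemma lrmorphism_exists (K : fieldType) (A B : algType K) (f : A -> B) :
  linear f -> monoid_morphism f -> exists phi : {lrmorphism A -> B}, phi =1 f.
Proof.
move=> lf mf.
pose F := HB.pack_for {lrmorphism A -> B} f (GRing.isLinear.Build K A B *:%R f lf)
  (GRing.isMonoidMorphism.Build A B f mf).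
by exists F.
Qed.

Theorem proposition6p3 (K : closedFieldType) (n : nat) (r s : K)
    (hn : (2 <= n)%N) (hr : r != 0) (hs : s != 0) (hrs : r != s)
    (HU : hopf_alg (Urs n r s)) (specU : is_Urs_hopf HU)
    (HV : hopf_alg (Uhat n r s)) (specV : is_Uhat_hopf HV) :
  exists phi : {lrmorphism Uhat n r s -> Urs n r s},
    [/\ hopf_morphism HV HU phi,
        forall i : 'I_n, phi (hL r s i) =
          (\prod_(j < n | (j < i)%N) ua r s j) *
          (\prod_(j < n | (i < j)%N) ubV r s j),
        forall i : 'I_n, phi (hK r s i) =
          (\prod_(j < n | (j < i)%N) ubV r s j) *
          (\prod_(j < n | (i < j)%N) ua r s j),
        forall i : 'I_n.-1, phi (hE r s i) =
          (- s^-1 * (r - s) ^+ 2) *: ue r s i &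
        forall i : 'I_n.-1, phi (hF r s i) = omega'V r s i * uf r s i].
Proof.
have [f [lf mf fE]] :=
  @presented_morphism K (Hgens n) (Urs n r s) (phi_gen r s) (@Hrel K n r s)
    (ext_rel hr hs hrs).
have [phi phif] := @lrmorphism_exists K (Uhat n r s) (Urs n r s) f lf mf.
have phi_pgen g : phi (pgen (@Hrel K n r s) g) = phi_gen r s g by rewrite phif fE.
(* The four formulas are values of [phi_gen], up to unfolding [torus]. *)
exists phi; split=> [|i|i|i|i]; try exact: phi_pgen.
have [gV EV FV] := specV.
have ggen g : Htoral g -> grouplike HV (pgen (@Hrel K n r s) g).
  by case: g => //= i _; case: (gV i).
have lphi : linear phi := linearP phi.
have phiLratio j : phi (hL r s (hi j) * hLV r s (lo j)) = omega r s j.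
  by rewrite rmorphM /= [phi _](phi_pgen (HL _)) [phi _](phi_pgen (HLV _)); exact: phiL_ratio.
have phiKratio j : phi (hK r s (hi j) * hKV r s (lo j)) = omega'V r s j.
  by rewrite rmorphM /= [phi _](phi_pgen (HK _)) [phi _](phi_pgen (HKV _)); exact: phiK_ratio.
have comul_gen g : comul HU (phi (pgen (@Hrel K n r s) g)) =
    tmap phi phi (comul HV (pgen (@Hrel K n r s) g)).
  have [tg|] := boolP (Htoral g).
    by rewrite phi_pgen (grouplike_phi_gen specU tg).1 (ggen g tg).1 tmap_pure // phi_pgen.
  have tmap2 (x y z w : Uhat n r s) : tmap phi phi (pure x y + pure z w) =
      pure (phi x) (phi y) + pure (phi z) (phi w).
    have := tmap_linear lphi lphi 1 (pure x y) (pure z w).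
    by rewrite !scale1r !tmap_pure.
  case: g => // j _; rewrite phi_pgen.
  - rewrite [comul HV _](EV j) tmap2 phiLratio rmorph1 phi_pgen.
    exact: comul_phiE.
  - rewrite [comul HV _](FV j) tmap2 phiKratio rmorph1 phi_pgen.
    exact: comul_phiF.
(* Off the torus both counits vanish, because the generator and its image are skew primitive. *)
have counit_gen g : counit HU (phi (pgen (@Hrel K n r s) g)) =
    counit HV (pgen (@Hrel K n r s) g).
  have [tg|] := boolP (Htoral g).
    by rewrite phi_pgen (grouplike_phi_gen specU tg).2 (ggen g tg).2.
  case: g => // j _; rewrite phi_pgen.
  - rewrite (skew_primitive_counit _ (EV j)); last first.
      by apply: grouplikeM; [case: (gV (hi j)) | case: (gV (lo j))].
    exact: (skew_primitive_counit (grouplike_omega specU j) (comul_phiE specU j)).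
  - rewrite (skew_primitive_counit _ (FV j)); last first.
      by apply: grouplikeM; [case: (gV (hi j)) | case: (gV (lo j))].
    exact: (skew_primitive_counit (grouplike_omega'V specU j) (comul_phiF specU j)).
(* Coproducts and counits are algebra morphisms, so induction on words reduces both conditions to
   generators. *)
apply: hopf_morphism_bialgebra => x.
  elim/presented_ind: x => [|c x y IHx IHy|g y IHy].
  - by rewrite !rmorph1 tmap1.
  (* The induction speaks of the operations of [presented]; they are restated as those of [Uhat],
     for which [phi] is a morphism. *)
  - rewrite -[(c *: x + y)%R]/((c *: (x : Uhat n r s) + y)%R).
    by rewrite !linearP /= IHx IHy tmap_linear.
  - rewrite -[(pgen _ g * y)%R]/(((pgen _ g : Uhat n r s) * y)%R).
    by rewrite !rmorphM /= IHy tmapM comul_gen.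
elim/presented_ind: x => [|c x y IHx IHy|g y IHy].
- by rewrite !rmorph1.
- rewrite -[(c *: x + y)%R]/((c *: (x : Uhat n r s) + y)%R).
  by rewrite !linearP /= IHx IHy.
- rewrite -[(pgen _ g * y)%R]/(((pgen _ g : Uhat n r s) * y)%R).
  by rewrite !rmorphM /= IHy counit_gen.
Qed.
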